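(* Let $\mathbb D\subseteq\mathbb R^d$ be a convex closed set with nonempty interior. Let $M=(M^1,\dots,M^d)$ be a regular local martingale field such that $M^i(t,x,\omega)=M^i(t,x_i,\omega)$ depends on $x$ only through $x_i$, and let $G=H+b$ be an admissible drift with decomposition such that $b^i(t,x,\omega)$ depends on $x$ only through $x_i$. Assume that: (a) the flow $\Psi_{s,t}$ generated by $\mathrm d\psi^i(t)=b^i(t,\psi^i(t))\,\mathrm dt+M^i(\mathrm dt,\psi^i(t))$ satisfies $\Psi_{s,t}(\mathbb D,\omega)=\mathbb D$ for all $t>s\ge 0$, $\omega\in\Omega$; (b) $(H,\mathbb D)$ admits an inward approximation; (c) (global existence) there is a set $\Omega_0$ of full measure such that for all $s\ge0$, $\eta\in C$ and $\omega\in\Omega_0$ the solution of the pathwise equation with initial time $s$ and initial function $\eta$ does not explode in finite time; (d) $G(t,\eta,\omega)\equiv G(\eta)$ and the local characteristic $a^{ij}(t,x,y,\omega)\equiv a^{ij}(x,y)$ of $M$ are deterministic and autonomous. Let $(\vartheta,\varphi)$ be the filtered random dynamical system generated in $C_{\mathbb D}$ by $$\mathrm dx^i(t)=G^i(x_t)\,\mathrm dt+M^i(\mathrm dt,x^i(t)),\qquad i=1,\dots,d.$$ If $G$ is quasimonotone in $\mathbb D$, then $(\vartheta,\varphi)$ is an order-preserving filtered random dynamical system in $C_{\mathbb D}$, i.e. for $\eta,\xi\in C_{\mathbb D}$, $$\eta\le\xi\quad\text{implies}\quad\varphi(t,\omega)\eta\le\varphi(t,\omega)\xi\quad\text{for all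 }t\ge0\text{ and }\omega\in\Omega.$$
   Context: Fix $r>0$, an integer $d\ge1$, and let $C=C([-r,0],\mathbb R^d)$ with the supremum norm $\|\cdot\|_C$. For a continuous function $x$ defined on a set containing $[s-r,s]$, $x_s\in C$ is $x_s(u)=x(s+u)$, $u\in[-r,0]$. For $\mathbb D\subset\mathbb R^d$, $C_{\mathbb D}=\{\eta\in C:\eta(u)\in\mathbb D\ \text{for every }u\in[-r,0]\}$. For $\eta,\eta_*\in C$, $\eta\ge\eta_*$ means $\eta^i(u)\ge\eta_*^i(u)$ for all $u\in[-r,0]$, $i=1,\dots,d$. Let $(\Omega,\mathcal F,(\mathcal F_t)_{t\ge0},\mathbf P)$ be a filtered probability space satisfying the usual conditions. Quasimonotone in $\mathbb D$ (for autonomous $G$): for all $\eta,\eta_*\in C_{\mathbb D}$ and $i=1,\dots,d$, $\{\eta\ge\eta_*,\ \eta^i(0)=\eta_*^i(0)\}\Rightarrow G^i(\eta)\ge G^i(\eta_* )$. Regular local martingale field: $M^i:[0,\infty)\times\mathbb R^d\times\Omega\to\mathbb R$, $i=1,\dots,d$, such that (i) $M^i$ is continuous in the first two variables for each $\omega$; (ii) for each $x$, $M^i(\cdot,x)$ is a local martingale with $M^i(0,x,\omega)=0$ for all $\omega$; (iii) there are $\delta\in(0,1)$ and predictable processes $a^{ij}:[0,\infty)\times\mathbb R^{2d}\times\Omega\to\mathbb R$ (the local characteristic) with $\langle M^i(\cdot,x),M^j(\cdot,y)\rangle_t=\int_0^ta^{ij}(u,x,y,\omega)\,\mathrm du$ a.s.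 such that, with $\bar a^{ij}=\mathrm D_x\mathrm D_ya^{ij}$ (the matrix of mixed partial derivatives), $$R^{ij}(t,\omega)=\sup_{x,y}\frac{|a^{ij}(t,x,y)|}{(1+|x|)(1+|y|)}+\sup_{x,y}\|\bar a^{ij}(t,x,y)\|+\sup_{x\ne x',\,y\ne y'}\frac{\|\bar a^{ij}(t,x,y)-\bar a^{ij}(t,x,y')-\bar a^{ij}(t,x',y)+\bar a^{ij}(t,x',y')\|}{|x-x'|^\delta|y-y'|^\delta}$$ is finite and $t\mapsto R^{ij}(t,\omega)$ is locally integrable for every $\omega$ and all $i,j$. Admissible drift with decomposition $G=H+b$: $G:[0,\infty)\times C\times\Omega\to\mathbb R^d$ and $G(t,\eta,\omega)=H(t,\eta,\omega)+b(t,\eta(0),\omega)$, where each of $G$, $H$ (on $C$) and $b$ (on $\mathbb R^d$ in place of $C$) is (i) jointly continuous in the first two variables for each $\omega$; (ii) for each $\omega$, each $T>0$ and each bounded set $B$, Lipschitz in the second variable on $B$ with a constant $L(T,B,\omega)<\infty$ uniform in $t\in[0,T]$; (iii) $\mathcal F_t$-measurable at time $t$ for each fixed value of the second variable. Moreover $b(t,\cdot)$ is continuously differentiable and there are $\delta>0$ and $c(T,\omega)<\infty$ with $$\sup_{0\le t\le T}\Big\{\sup_x\|\mathrm Db(t,x,\omega)\|+\sup_{x\ne y}\frac{\|\mathrm Db(t,x,\omega)-\mathrm Db(t,y,\omega)\|}{|x-y|^\delta}\Big\}\le c(T,\omega).$$ Flow: $M^i(\mathrm dt,\cdot)$ denotes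 Kunita's stochastic differential. It is known (Kunita) that there is $\Psi:[0,\infty)^2\times\mathbb R^d\times\Omega\to\mathbb R^d$ such that for each $s,x$, $t\mapsto\Psi_{s,t}(x)$, $t\ge s$, solves the (here diagonal) system $\mathrm d\psi^i=b^i(t,\psi^i)\,\mathrm dt+M^i(\mathrm dt,\psi^i)$ with $\psi(s)=x$; $\Psi_{s,s}(x,\omega)=x$; $(s,t,x)\mapsto\Psi_{s,t}(x,\omega)$ and $(s,t,x)\mapsto\mathrm D_x\Psi_{s,t}(x,\omega)$ are continuous for each $\omega$; each $\Psi_{s,t}(\cdot,\omega)$ is a $C^1$-diffeomorphism of $\mathbb R^d$, acting componentwise; and $\Psi_{s,u}(\cdot,\omega)=\Psi_{t,u}(\cdot,\omega)\circ\Psi_{s,t}(\cdot,\omega)$ for all $s,t,u\ge0$ and all $\omega$. Pathwise equation (with $H$, initial time $s\ge0$, initial function $\eta\in C$): with $\Psi(u,x,\omega)=\Psi_{0,u}(x,\omega)$, $\xi(u,x,\omega)=\Psi(u,\cdot,\omega)^{-1}(x)$, $F(u,x,\eta,\omega)=\{\mathrm D_x\Psi(u,x,\omega)\}^{-1}H(u,\eta,\omega)$, $$x(t,\omega)=\Psi\Big(t,\Big[\xi(s,\eta(0),\omega)+\int_s^tF\big(u,\xi(u,x(u,\omega),\omega),x_u(\omega),\omega\big)\,\mathrm du\Big],\omega\Big),\ t\ge s;\qquad x(t,\omega)=\eta(t-s),\ t\in[s-r,s].$$ It is equivalent to the stochastic functional differential equation with $x_s=\eta$. It is known that, on a set of full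 measure, for all $s\ge0$ and $\eta\in C$ it has a unique local solution up to an explosion time, continuous in $(t,\eta)$. Inward approximation of $(H,\mathbb D)$: there are $\varepsilon_0>0$ and admissible drifts $G_\varepsilon=H_\varepsilon+b$, $\varepsilon\in(0,\varepsilon_0]$ (same $b$), such that (i) for each $\varepsilon$, $T>0$, $\omega$ there are $c<\infty$ and $\gamma\in[0,1)$ with $|H_\varepsilon(t,\eta,\omega)|\le c(1+\|\eta\|_C^\gamma)$ for all $0\le t\le T$, $\eta\in C$; (ii) $\lim_{\varepsilon\to0}H_\varepsilon(t,\eta,\omega)=H(t,\eta,\omega)$ for all $t\ge0$, $\eta\in C_{\mathbb D}$, $\omega$; (iii) for all $t\ge0$, $\eta\in C_{\mathbb D}$, $\varepsilon$, $\omega$ there is $\alpha>0$ such that $\eta(0)+hH_\varepsilon(t,\eta,\omega)+hu\in\mathbb D$ whenever $0<h\le\alpha$, $u\in\mathbb R^d$, $|u|\le\alpha$; (iv) for all $\omega$, $s\ge0$, $t\ge s$, $\eta\in C$, the solutions $y^\varepsilon$ of the pathwise equation with $H_\varepsilon$ in place of $H$ converge at time $t$ to the solution $x$ with $H$ (same $s,\eta$) as $\varepsilon\to0$. Random dynamical systems: a metric dynamical system (MDS) $\vartheta$ is a probability space $(\Omega,\mathcal F,\mathbf P)$ with measure-preserving maps $\vartheta(t):\Omega\to\Omega$, $t\in\mathbb R$, with $\vartheta(0)=\mathrm{id}$, $\vartheta(t)\circ\vartheta(s)=\vartheta(t+s)$ and $(t,\omega)\mapsto\vartheta(t)\omega$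 measurable. A random dynamical system (RDS) $(\vartheta,\varphi)$ on a topological space $X$ is an MDS with a measurable map $\varphi:\mathbb R_+\times\Omega\times X\to X$, $(t,\omega,x)\mapsto\varphi(t,\omega)x$, such that $x\mapsto\varphi(t,\omega)x$ is continuous, $\varphi(0,\omega)=\mathrm{id}$ and $\varphi(t+s,\omega)=\varphi(t,\vartheta(s)\omega)\circ\varphi(s,\omega)$ for all $t,s\ge0$ and all $\omega$. A filtered MDS is an MDS with a family $(\mathcal F_t)_{t\in\mathbb R}$ of sub-$\sigma$-algebras of the $\mathbf P$-completion of $\mathcal F$ that is increasing, right-continuous, contains all $\mathbf P$-null sets of $\mathcal F$, and is such that $\vartheta(s)$ is $(\mathcal F_{t+s},\mathcal F_t)$-measurable for all $s,t\in\mathbb R$. A filtered RDS is an RDS over a filtered MDS such that $\varphi(t,\cdot)x$ is $(\mathcal F_t,\mathcal B(X))$-measurable for all $t\ge0$, $x\in X$. The filtered RDS generated by the equation in $C_{\mathbb D}$: under (a)–(d), there are a filtered MDS carrying a field with the same law as $M$ (again denoted $M$) and a filtered RDS over it with state space $C_{\mathbb D}$ given by $[\varphi(t,\omega)\eta](\tau)=x(t+\tau,\eta,\omega)$ if $t+\tau>0$ and $=\eta(t+\tau)$ if $t+\tau\le0$, $\tau\in[-r,0]$, where $x(\cdot,\eta,\omega)$ is the solution of the pathwise equation driven by this $M$ with initial time $0$ and initial function $\eta$. Null sets are discarded (or solutions modified on them) so that the stated pathwise properties hold for every $\omega$. *)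

(* Defs.v *)
From HB Require Import structures.
From mathcomp Require Import all_boot all_order all_algebra.
From mathcomp Require Import all_classical all_reals all_analysis.
From mathcomp Require Import measurable_realfun.

Set Implicit Arguments.
Unset Strict Implicit.
Unset Printing Implicit Defensive.

Import Order.TTheory GRing.Theory Num.Theory.
Import numFieldNormedType.Exports.

Local Open Scope classical_set_scope.
Local Open Scope ring_scope.

(* Conventions.
   - R^d is ['rV[R]_d]; [x 0 i] is the i-th coordinate.  Its library norm is the
     max norm; every norm condition below is insensitive to passing to an
     equivalent norm.  A Jacobian ['J f x] acts on row vectors from the right.
   - Time is the whole of R; conditions are imposed for nonnegative times only,
     except for metric dynamical systems.
   - Sample points are the last argument of random functions. *)

Section history.
Context (R : realType) (r : {posnum R}) (d : nat).

Definition delay_itv : set R := `[- r%:num, 0].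

Definition history := continuousType delay_itv 'rV[R]_d.

HB.instance Definition _ := Choice.on history.

Definition hist_norm (eta : history) : R := sup (range (fun u => `|eta u|)).

Definition hist_dist (eta eta' : history) : R :=
  sup (range (fun u => `|eta u - eta' u|)).

Lemma zero_delay : 0 \in delay_itv.
Proof. by rewrite inE /delay_itv /= in_itv /= lexx oppr_le0 andbT. Qed.

Definition now : delay_itv := exist _ 0 zero_delay.

Let clamp (t : R) : R := Num.max (- r%:num) (Num.min t 0).

Let clampP t : clamp t \in delay_itv.
Proof.
rewrite inE /delay_itv /= in_itv /= /clamp le_max lexx /= ge_max oppr_le0.
by rewrite ltW //= ge_min lexx orbT.
Qed.

Let clampS t : delay_itv := exist _ (clamp t) (clampP t).

Let clamp_cts : continuous clampS.
Proof.
apply: continuous_comp_initial => t /=.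
rewrite (_ : _ \o _ = clamp) //.
suff : {for t, continuous ((fun=> - r%:num : R^o) \max (id \min (fun=> 0 : R^o)))}.
  by [].
apply: continuous_max; first exact: cvg_cst.
by apply: continuous_min; [exact: cvg_id|exact: cvg_cst].
Qed.

Let hist_bounded (f : delay_itv -> 'rV[R]_d) :
  continuous f -> has_ubound (range (fun u => `|f u|)).
Proof.
move=> cf.
have cg : continuous (fun t => `|f (clampS t)|).
  move=> t; apply: (@cvg_norm _ _ _ _ _ (f \o clampS)).
  by apply: continuous_comp; [exact: clamp_cts|exact: cf].
have le0 : - r%:num <= 0 :> R by rewrite oppr_le0.
have [c _ cmax] := @EVT_max _ (fun t => `|f (clampS t)|) _ _ le0
  (continuous_subspaceT cg).
exists `|f (clampS c)| => _ [u _ <-].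
have uI : \val u \in `[- r%:num, 0].
  by have := valP u; rewrite inE.
suff -> : u = clampS (\val u) by exact: cmax.
apply/val_inj => /=; move: uI; rewrite in_itv /= => /andP[h1 h2].
by rewrite /clamp; rewrite min_l // max_r.
Qed.

Let dist_ub (eta eta' : history) :
  has_ubound (range (fun u => `|eta u - eta' u|)).
Proof.
apply: (hist_bounded (f := fun u => eta u - eta' u)) => u.
apply: cvgB; [exact: nbhs_filter|exact: (@cts_fun _ _ eta)|exact: (@cts_fun _ _ eta')].
Qed.

Let le_dist (eta eta' : history) u : `|eta u - eta' u| <= hist_dist eta eta'.
Proof. by apply: ub_le_sup; [exact: dist_ub|exists u]. Qed.

Let dist_le (eta eta' : history) c :
  (forall u, `|eta u - eta' u| <= c) -> hist_dist eta eta' <= c.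
Proof.
move=> h; apply: ge_sup; first by exists `|eta now - eta' now|, now.
by move=> _ [u _ <-].
Qed.

Let dist_ge0 (eta eta' : history) : 0 <= hist_dist eta eta'.
Proof. exact: le_trans (le_dist eta eta' now). Qed.

Let distxx (eta : history) : hist_dist eta eta = 0.
Proof.
by apply/eqP; rewrite eq_le dist_ge0 andbT dist_le // => u; rewrite subrr normr0.
Qed.

Let dist_eq0 (eta eta' : history) : hist_dist eta eta' = 0 -> eta = eta'.
Proof.
move=> h; apply/continuousEP => u; apply/eqP; rewrite -subr_eq0 -normr_eq0.
by rewrite eq_le normr_ge0 andbT -h le_dist.
Qed.

Let dist_sym (eta eta' : history) : hist_dist eta eta' = hist_dist eta' eta.
Proof.
rewrite /hist_dist; have -> : (fun u => `|eta u - eta' u|) =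
  (fun u => `|eta' u - eta u|) by apply/funext => u; rewrite distrC.
by [].
Qed.

Let dist_triangle (y x z : history) :
  hist_dist x z <= hist_dist x y + hist_dist y z.
Proof.
apply: dist_le => u; apply: (le_trans (ler_distD (y u) _ _)).
by rewrite lerD // le_dist.
Qed.

HB.instance Definition _ := @isMetric.Build R history
  hist_dist distxx dist_eq0 dist_sym dist_triangle.

Definition hist_cst (c : 'rV[R]_d) : history := cst c : continuousType _ _.

(* The element x_s of C; the default value is only taken when x is not
   continuous on [s - r, s]. *)
Definition segment (x : R -> 'rV[R]_d) (s : R) : history :=
  xget (hist_cst 0) [set eta : history | forall u, eta u = x (s + \val u)].

Definition hist_le (eta xi : history) : Prop :=
  forall u i, eta u 0 i <= xi u 0 i.

Definition hist_in (D : set 'rV[R]_d) : set history :=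
  [set eta | forall u, D (eta u)].

Definition quasimonotone (D : set 'rV[R]_d) (G : history -> 'rV[R]_d) : Prop :=
  forall eta eta', hist_in D eta -> hist_in D eta' -> forall i,
    hist_le eta' eta -> eta now 0 i = eta' now 0 i ->
    G eta' 0 i <= G eta 0 i.

End history.

Section processes.
Context (R : realType) (dT : measure_display) (T : measurableType dT).
Context (P : probability T R).

(* The completion of P; its measurable sets are those of
   [completed_algebra_gen P]. *)
Definition completion := @completed_measure_extension _ T R P.

HB.instance Definition _ := Measure.on completion.

Record is_filtration (I : set R) (F : R -> set (set T)) : Prop := {
  filtration_sigma : forall t, I t -> sigma_algebra setT (F t) ;
  filtration_sub : forall t, I t -> F t `<=` completed_algebra_gen P ;
  filtration_le : forall s t, I s -> I t -> s <= t -> F s `<=` F t ;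
  filtration_right : forall t, I t ->
    \bigcap_(u in [set u | t < u]) F u `<=` F t ;
  filtration_null : forall t, I t -> forall A, measurable A -> P A = 0%E ->
    F t A
}.

Definition usual_conditions (F : R -> set (set T)) : Prop :=
  measure_is_complete P /\ is_filtration [set t | 0 <= t] F.

Definition measurable_wrt (S : set (set T)) (X : T -> R) : Prop :=
  forall B : set R, measurable B -> S (X @^-1` B).

Definition adapted (F : R -> set (set T)) (X : R -> T -> R) : Prop :=
  forall t, 0 <= t -> measurable_wrt (F t) (X t).

Definition martingale (F : R -> set (set T)) (X : R -> T -> R) : Prop :=
  [/\ adapted F X,
      forall t, 0 <= t -> completion.-integrable setT (EFin \o X t) &
      forall s t A, 0 <= s -> s <= t -> F s A ->
        (\int[completion]_(w in A) (X t w)%:E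
         = \int[completion]_(w in A) (X s w)%:E)%E].

Definition stopping_time (F : R -> set (set T)) (tau : T -> \bar R) : Prop :=
  (forall w, 0 <= tau w)%E /\
  forall t, 0 <= t -> F t [set w | (tau w <= t%:E)%E].

Definition stopped (X : R -> T -> R) (tau : T -> \bar R) (t : R) (w : T) : R :=
  X (fine (Order.min t%:E (tau w))) w.

Definition local_martingale (F : R -> set (set T)) (X : R -> T -> R) : Prop :=
  adapted F X /\
  exists tau : nat -> T -> \bar R,
    [/\ forall n, stopping_time F (tau n),
        {ae P, forall w, forall n, (tau n w <= tau n.+1 w)%E},
        {ae P, forall w, tau n w @[n --> \oo] --> +oo%E} &
        forall n, martingale F (fun t w => stopped X (tau n) t w - X 0 w)].

(* A is a version of the joint quadratic variation <X, Y> of the continuous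
   local martingales X and Y. *)
Definition is_bracket (F : R -> set (set T)) (X Y A : R -> T -> R) : Prop :=
  [/\ adapted F A,
      forall w, A 0 w = 0,
      forall w, {within [set t | 0 <= t], continuous (A ^~ w)},
      forall w t, 0 <= t -> bounded_variation 0 t (A ^~ w) &
      local_martingale F (fun t w => X t w * Y t w - A t w)].

Definition predictable_rectangles (F : R -> set (set T)) : set (set (R * T)) :=
  [set E | (exists2 A, F 0 A & E = [set 0] `*` A) \/
           exists s t A, [/\ 0 <= s, s < t, F s A & E = `]s, t] `*` A]].

Definition predictable (F : R -> set (set T)) (X : R -> T -> R) : Prop :=
  let D := [set p : R * T | 0 <= p.1] in
  forall B : set R, measurable B ->
    <<s D, predictable_rectangles F >> (D `&` (fun p => X p.1 p.2) @^-1` B).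

End processes.
Arguments completion {R dT T} P _.


Section fields.
Context (R : realType) (d : nat).

Definition jointly_continuous (X : topologicalType)
    (f : R -> X -> 'rV[R]_d) : Prop :=
  {within [set p : R * X | 0 <= p.1], continuous (fun p => f p.1 p.2)}.

(* [mixed_partials f x y] has entries d^2 f / dx_k dy_l at (x, y). *)
Definition mixed_partials (f : 'rV[R]_d -> 'rV[R]_d -> R) (x y : 'rV[R]_d) :
    'M[R]_d :=
  \matrix_(k, l)
    'D_(delta_mx 0 k) (fun x' => 'D_(delta_mx 0 l) (f x') y) x.

Definition mixed_derivable (f : 'rV[R]_d -> 'rV[R]_d -> R) : Prop :=
  forall k l x y,
    derivable (f x) y (delta_mx 0 l) /\
    derivable (fun x' => 'D_(delta_mx 0 l) (f x') y) x (delta_mx 0 k).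

Definition characteristic_bound (delta : R) (f : 'rV[R]_d -> 'rV[R]_d -> R) :
    \bar R :=
  let g := mixed_partials f in
  (ereal_sup [set z | exists x y,
      z = (`|f x y| / ((1 + `|x|) * (1 + `|y|)))%:E]
   + ereal_sup [set z | exists x y, z = `|g x y|%:E]
   + ereal_sup [set z | exists x x' y y', [/\ x != x', y != y' &
      z = (`|g x y - g x y' - g x' y + g x' y'|
             / (`|x - x'| `^ delta * `|y - y'| `^ delta))%:E]])%E.

Context (dT : measure_display) (T : measurableType dT) (P : probability T R).
Context (F : R -> set (set T)).
Implicit Types (M b : R -> 'rV[R]_d -> T -> 'rV[R]_d).

Definition componentwise (f : 'rV[R]_d -> 'rV[R]_d) : Prop :=
  forall i (x y : 'rV[R]_d), x 0 i = y 0 i -> f x 0 i = f y 0 i.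

Record regular_field M
    (a : 'I_d -> 'I_d -> R -> 'rV[R]_d -> 'rV[R]_d -> T -> R) : Prop := {
  field_continuous : forall w, jointly_continuous (fun t x => M t x w) ;
  field_local_martingale : forall i x,
    local_martingale P F (fun t w => M t x w 0 i) ;
  field_start : forall x w, M 0 x w = 0 ;
  field_predictable : forall i j x y, predictable F (fun t w => a i j t x y w) ;
  field_bracket : forall i j x y, exists A,
    is_bracket P F (fun t w => M t x w 0 i) (fun t w => M t y w 0 j) A /\
    forall t, 0 <= t ->
      {ae P, forall w, A t w = \int[lebesgue_measure]_(u in `[0, t]) a i j u x y w} ;
  field_derivable : forall i j t w, 0 <= t ->
    mixed_derivable (fun x y => a i j t x y w) ;
  field_characteristic : exists delta, [/\ 0 < delta, delta < 1 &
    forall i j w,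
      let Rij t := characteristic_bound delta (fun x y => a i j t x y w) in
      (forall t, 0 <= t -> (Rij t < +oo)%E) /\
      forall T0, 0 < T0 -> lebesgue_measure.-integrable `[0, T0] Rij]
}.

(* Sum over the partition s = t_0 < ... < t_n of
     N(t_(k+1) /\ t, f_(t_k /\ t)) - N(t_k /\ t, f_(t_k /\ t)). *)
Definition kunita_sum (N : R -> 'rV[R]_d -> T -> R) (f : R -> T -> 'rV[R]_d)
    (s : R) (p : seq R) (t : R) (w : T) : R :=
  \sum_(k < size p)
    let t0 := Num.min (nth 0 (s :: p) k) t in
    let t1 := Num.min (nth 0 (s :: p) k.+1) t in
    N t1 (f t0 w) w - N t0 (f t0 w) w.

(* [I t] is the stochastic integral of N(du, f_u) over [s, t] for a continuous
   adapted integrand f: the Riemann sums converge to it in probability,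
   uniformly on compact time intervals, as the mesh tends to 0. *)
Definition kunita_integral (N : R -> 'rV[R]_d -> T -> R)
    (f : R -> T -> 'rV[R]_d) (s : R) (I : R -> T -> R) : Prop :=
  forall T0 e, s < T0 -> 0 < e -> exists2 h, 0 < h &
    forall p, itv_partition s T0 p ->
      (forall k, (k < size p)%N ->
        nth 0 (s :: p) k.+1 - nth 0 (s :: p) k < h) ->
      exists A, [/\ measurable A, (P A <= e%:E)%E &
        forall w t, ~ A w -> s <= t -> t <= T0 ->
          `|kunita_sum N f s p t w - I t w| <= e].

Definition C1 (f : 'rV[R]_d -> 'rV[R]_d) : Prop :=
  (forall x, differentiable f x) /\ continuous (fun x => 'J f x).

Definition C1_diffeomorphism (f : 'rV[R]_d -> 'rV[R]_d) : Prop :=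
  exists g, [/\ cancel f g, cancel g f, C1 f & C1 g].

Definition vint (s t : R) (f : R -> 'rV[R]_d) : 'rV[R]_d :=
  \row_i \int[lebesgue_measure]_(u in `[s, t]) (f u 0 i).

(* [Psi s t x w] is Psi_{s,t}(x, w). *)
Record generated_flow M b (Psi : R -> R -> 'rV[R]_d -> T -> 'rV[R]_d) : Prop := {
  flow_adapted : forall s t x i, 0 <= s -> s <= t ->
    measurable_wrt (F t) (fun w => Psi s t x w 0 i) ;
  flow_sde : forall s x, 0 <= s -> exists I : R -> T -> 'rV[R]_d,
    (forall i, kunita_integral (fun t y w => M t y w 0 i)
                 (fun u w => Psi s u x w) s (fun t w => I t w 0 i)) /\
    {ae P, forall w, forall t, s <= t ->
      Psi s t x w = x + vint s t (fun u => b u (Psi s u x w) w) + I t w} ;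
  flow_id : forall s x w, 0 <= s -> Psi s s x w = x ;
  flow_continuous : forall w,
    {within [set p : R * R * 'rV[R]_d | 0 <= p.1.1 /\ 0 <= p.1.2],
      continuous (fun p => Psi p.1.1 p.1.2 p.2 w)} ;
  flow_jacobian_continuous : forall w,
    {within [set p : R * R * 'rV[R]_d | 0 <= p.1.1 /\ 0 <= p.1.2],
      continuous (fun p => 'J (fun x => Psi p.1.1 p.1.2 x w) p.2)} ;
  flow_diffeomorphism : forall s t w, 0 <= s -> 0 <= t ->
    C1_diffeomorphism (fun x => Psi s t x w) ;
  flow_componentwise : forall s t w, 0 <= s -> 0 <= t ->
    componentwise (fun x => Psi s t x w) ;
  flow_compose : forall s t u x w, 0 <= s -> 0 <= t -> 0 <= u ->
    Psi s u x w = Psi t u (Psi s t x w) w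
}.

Record regular_functional (X : topologicalType) (dist : X -> X -> R)
    (G : R -> X -> T -> 'rV[R]_d) : Prop := {
  functional_continuous : forall w, jointly_continuous (fun t x => G t x w) ;
  functional_lipschitz : forall w T0 (B : set X), 0 < T0 ->
    (exists x0 K, forall x, B x -> dist x0 x <= K) ->
    exists L, forall t x y, 0 <= t -> t <= T0 -> B x -> B y ->
      `|G t x w - G t y w| <= L * dist x y ;
  functional_adapted : forall x i, adapted F (fun t w => G t x w 0 i)
}.

Definition C1_holder_bound (delta : R) (f : 'rV[R]_d -> 'rV[R]_d) : \bar R :=
  (ereal_sup [set z | exists x, z = `|'J f x|%:E]
   + ereal_sup [set z | exists x y, x != y /\
       z = (`|'J f x - 'J f y| / `|x - y| `^ delta)%:E])%E.

Context (r : {posnum R}).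
Implicit Types (G H : R -> history r d -> T -> 'rV[R]_d).

Record admissible G H b : Prop := {
  drift_decomposition : forall t eta w, 0 <= t ->
    G t eta w = H t eta w + b t (eta (now r)) w ;
  drift_G : regular_functional (@hist_dist R r d) G ;
  drift_H : regular_functional (@hist_dist R r d) H ;
  drift_b : regular_functional (fun x y : 'rV[R]_d => `|x - y|) b ;
  drift_b_C1 : forall t w, 0 <= t -> C1 (fun x => b t x w) ;
  drift_b_holder : exists2 delta, 0 < delta &
    forall T0 w, 0 < T0 -> exists c : R, forall t, 0 <= t -> t <= T0 ->
      (C1_holder_bound delta (fun x => b t x w) <= c%:E)%E
}.

Context (Psi : R -> R -> 'rV[R]_d -> T -> 'rV[R]_d).

(* The inverse of the bijection Psi_{0,u}(., w). *)
Definition flow_inverse (u : R) (x : 'rV[R]_d) (w : T) : 'rV[R]_d :=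
  pinv setT (fun z => Psi 0 u z w) x.

Definition pathwise_rhs H (u : R) (x : 'rV[R]_d) (eta : history r d) (w : T) :
    'rV[R]_d :=
  H u eta w *m invmx ('J (fun z => Psi 0 u z w) x).

(* The solution lives on [s - r, beta[. *)
Definition pathwise_solution H (s : R) (eta : history r d) (w : T)
    (beta : \bar R) (x : R -> 'rV[R]_d) : Prop :=
  [/\ {within [set t | s - r%:num <= t /\ (t%:E < beta)%E], continuous x},
      forall u, x (s + \val u) = eta u &
      forall t, s <= t -> (t%:E < beta)%E ->
        x t = Psi 0 t
          (flow_inverse s (eta (now r)) w
           + vint s t (fun u =>
               pathwise_rhs H u (flow_inverse u (x u) w) (segment r x u) w)) w].

(* x is "the solution" and does not explode: it is global, and every local
   solution is a restriction of it. *)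
Definition global_solution H (s : R) (eta : history r d) (w : T)
    (x : R -> 'rV[R]_d) : Prop :=
  pathwise_solution H s eta w +oo%E x /\
  forall beta y, (s%:E < beta)%E -> pathwise_solution H s eta w beta y ->
    forall t, s - r%:num <= t -> (t%:E < beta)%E -> y t = x t.

Record inward_family (D : set 'rV[R]_d) H b (eps0 : R)
    (Heps : R -> R -> history r d -> T -> 'rV[R]_d) : Prop := {
  inward_admissible : forall e, 0 < e -> e <= eps0 ->
    admissible (fun t eta w => Heps e t eta w + b t (eta (now r)) w)
      (Heps e) b ;
  inward_growth : forall e T0 w, 0 < e -> e <= eps0 -> 0 < T0 ->
    exists c gamma, [/\ 0 <= gamma, gamma < 1 &
      forall t eta, 0 <= t -> t <= T0 ->
        `|Heps e t eta w| <= c * (1 + hist_norm eta `^ gamma)] ;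
  inward_limit : forall t eta w, 0 <= t -> hist_in D eta ->
    Heps e t eta w @[e --> 0^'+] --> H t eta w ;
  inward_pointing : forall t eta e w, 0 <= t -> hist_in D eta ->
    0 < e -> e <= eps0 ->
    exists2 alpha, 0 < alpha & forall h u, 0 < h -> h <= alpha ->
      `|u| <= alpha -> D (eta (now r) + h *: Heps e t eta w + h *: u) ;
  inward_convergence : forall w s eta x, 0 <= s -> global_solution H s eta w x ->
    exists2 y : R -> R -> 'rV[R]_d,
      (forall e, 0 < e -> e <= eps0 -> global_solution (Heps e) s eta w (y e)) &
      forall t, s <= t -> y e t @[e --> 0^'+] --> x t
}.

Definition inward_approximation (D : set 'rV[R]_d) H b : Prop :=
  exists2 eps0, 0 < eps0 & exists Heps, inward_family D H b eps0 Heps.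

Record delay_equation (D : set 'rV[R]_d) M
    (a : 'I_d -> 'I_d -> R -> 'rV[R]_d -> 'rV[R]_d -> T -> R) G H b : Prop := {
  equation_field : regular_field M a ;
  equation_field_diag : forall t w, 0 <= t -> componentwise (fun x => M t x w) ;
  equation_drift : admissible G H b ;
  equation_drift_diag : forall t w, 0 <= t -> componentwise (fun x => b t x w) ;
  equation_flow : generated_flow M b Psi ;
  equation_invariance : forall s t w, 0 <= s -> s < t ->
    (fun x => Psi s t x w) @` D = D ;
  equation_inward : inward_approximation D H b ;
  equation_global : {ae P, forall w, forall s eta, 0 <= s ->
    exists x, global_solution H s eta w x}
}.

End fields.


Section rds.
Context (R : realType) (dT : measure_display) (T : measurableType dT).
Context (P : probability T R).

Record metric_dynamical_system (theta : R -> T -> T) : Prop := {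
  mds_measurable : measurable_fun setT (fun p : R * T => theta p.1 p.2) ;
  mds_preserving : forall t A, measurable A -> P (theta t @^-1` A) = P A ;
  mds_id : forall w, theta 0 w = w ;
  mds_flow : forall t s w, theta t (theta s w) = theta (t + s) w
}.

Record filtered_mds (theta : R -> T -> T) (F : R -> set (set T)) : Prop := {
  fmds_mds : metric_dynamical_system theta ;
  fmds_filtration : is_filtration P setT F ;
  fmds_shift : forall s t A, F t A -> F (t + s) (theta s @^-1` A)
}.

Definition borel (X : topologicalType) : set (set X) := <<s @open X >>.

Definition rds_rectangles (X : topologicalType) : set (set (R * T * X)) :=
  [set E | exists (A : set R) (B : set T) (U : set X),
    [/\ measurable A, measurable B, borel U & E = A `*` B `*` U]].

Record random_dynamical_system (theta : R -> T -> T) (X : topologicalType)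
    (phi : R -> T -> X -> X) : Prop := {
  rds_mds : metric_dynamical_system theta ;
  rds_measurable : forall U : set X, borel U ->
    <<s @rds_rectangles X >>
      [set p : R * T * X | 0 <= p.1.1 /\ U (phi p.1.1 p.1.2 p.2)] ;
  rds_continuous : forall t w, 0 <= t -> continuous (phi t w) ;
  rds_id : forall w x, phi 0 w x = x ;
  rds_cocycle : forall t s w x, 0 <= t -> 0 <= s ->
    phi (t + s) w x = phi t (theta s w) (phi s w x)
}.

Record filtered_rds (theta : R -> T -> T) (F : R -> set (set T))
    (X : topologicalType) (phi : R -> T -> X -> X) : Prop := {
  frds_rds : random_dynamical_system theta phi ;
  frds_mds : filtered_mds theta F ;
  frds_adapted : forall t x (U : set X), 0 <= t -> borel U ->
    F t [set w | U (phi t w x)]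
}.

End rds.

Section generated.
Context (R : realType) (r : {posnum R}) (d : nat) (D : set 'rV[R]_d).
Context (dT : measure_display) (T : measurableType dT) (P : probability T R).
Context (dT' : measure_display) (T' : measurableType dT').
Context (P' : probability T' R).

(* Equality of the finite-dimensional distributions of the pairs (M, b) and
   (M', b'); when b is deterministic and b' = b, this says that M and M' have
   the same law. *)
Definition same_law (M b : R -> 'rV[R]_d -> T -> 'rV[R]_d)
    (M' b' : R -> 'rV[R]_d -> T' -> 'rV[R]_d) : Prop :=
  forall (n : nat) (t : 'I_n -> R) (x : 'I_n -> 'rV[R]_d)
    (A B : 'I_n -> 'I_d -> set R),
  (forall k, 0 <= t k) ->
  (forall k i, measurable (A k i) /\ measurable (B k i)) ->
  completion P [set w | forall k i,
    A k i (M (t k) (x k) w 0 i) /\ B k i (b (t k) (x k) w 0 i)] =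
  completion P' [set w | forall k i,
    A k i (M' (t k) (x k) w 0 i) /\ B k i (b' (t k) (x k) w 0 i)].

(* (theta, phi) is the filtered random dynamical system generated in C_D by
     dx^i(t) = G^i(x_t) dt + M^i(dt, x^i(t)):
   (M', b') is a copy of the driving data (M, b) on the filtered metric
   dynamical system, and phi is given by the solutions of the pathwise equation
   driven by M'.  Equality in law cannot constrain null sets, so the pathwise
   properties of the copy are required at every sample point. *)
Record generated_rds (G : history r d -> 'rV[R]_d)
    (a : 'I_d -> 'I_d -> 'rV[R]_d -> 'rV[R]_d -> R)
    (M b : R -> 'rV[R]_d -> T -> 'rV[R]_d)
    (theta : R -> T' -> T') (F' : R -> set (set T'))
    (M' : R -> 'rV[R]_d -> T' -> 'rV[R]_d)
    (H' : R -> history r d -> T' -> 'rV[R]_d)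
    (b' : R -> 'rV[R]_d -> T' -> 'rV[R]_d)
    (Psi' : R -> R -> 'rV[R]_d -> T' -> 'rV[R]_d)
    (phi : R -> T' -> hist_in (r := r) D -> hist_in (r := r) D) : Prop := {
  generated_frds : filtered_rds P' theta F' phi ;
  generated_law : same_law M b M' b' ;
  generated_equation : delay_equation P' F' Psi' D M'
    (fun i j _ x y _ => a i j x y) (fun _ eta _ => G eta) H' b' ;
  (* For t + tau <= 0, x (t + tau) is the value of eta at t + tau. *)
  generated_phi : forall w (eta : hist_in D),
    exists2 x, global_solution Psi' H' 0 (\val eta) w x &
    forall t, 0 <= t -> forall tau : delay_itv r,
      (\val (phi t w eta) : history r d) tau = x (t + \val tau)
}.

Definition order_preserving
    (phi : R -> T' -> hist_in (r := r) D -> hist_in (r := r) D) : Prop :=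
  forall eta xi : hist_in D, hist_le (\val eta) (\val xi) ->
    forall t w, 0 <= t -> hist_le (\val (phi t w eta)) (\val (phi t w xi)).

End generated.

(* Main.v *)
Require Import Defs.
From HB Require Import structures.
From mathcomp Require Import all_boot all_order all_algebra.
From mathcomp Require Import all_classical all_reals all_analysis.
From mathcomp Require Import lra ring.

(** Order preservation is a pathwise fact, so one sample point is fixed and the
    pathwise equation is treated as a deterministic delay equation.

    In the coordinates [z], with [x t = Psi_{0,t} (z t)], the noise disappears:
    each coordinate solves [z' = H^i (t, x_t) / J_ii], where [J] is the Jacobian
    of [Psi_{0,t}] at [z t].  Because the flow acts componentwise, [J] is
    diagonal; its entries are positive, since they never vanish and equal 1 at
    time 0; and [Psi_{0,t}] is increasing in each coordinate.  As it also maps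
    [D] onto [D], both the order and membership in [D] can be read off [z].

    The Jacobian is merely continuous in [z], so no Gronwall estimate is
    available.  Two solutions are compared through strictly ordered
    perturbations instead.  Choose interior points [p], [q] of [D] with
    [p^i < q^i] for all [i], and replace the drift [H (eta)] by
    [H (eta) + eps (p - eta 0)] for the lower path and by
    [H (eta) + eps (q - eta 0)] for the upper path.  The inward approximation
    makes [H] subtangential to [D], and by convexity the additional pull towards
    an interior point makes the perturbed drift point strictly inwards, so that
    perturbed paths cannot leave [D] ([stays_inside]).  Where the two paths meet
    in coordinate [i], quasimonotonicity and [p^i < q^i] make the upper
    coordinate strictly faster ([velocity_lt]), so the order cannot be lost
    either.  Real induction on time then gives [strict_comparison].

    Perturbed solutions exist by a Peano theorem for causal functionals
    ([peano]): Euler polygons are uniformly Lipschitz and have a limit along an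
    ultrafilter.  For boundedness the velocity is clipped at a level above its
    size along the true solutions.  As [eps] tends to 0 a second ultrafilter
    limit produces a solution of the clipped unperturbed equation
    ([perturbed_approximation]).  As long as it coincides with the true solution
    the clipping is inactive, so by the uniqueness contained in
    [global_solution] the two can never separate ([clipped_solution_unique]).
    Hence the true solutions are limits of ordered paths
    ([pathwise_comparison]).

    Both limits use the same tools: continuous convergence [cts_cvg], which is
    stable under composition with continuous maps and under passage to segments,
    and [approx_primitive], a form of the integral equation by elementary
    increment estimates that survives such limits ([approx_primitive_limit]). *)

Set Implicit Arguments.
Unset Strict Implicit.
Unset Printing Implicit Defensive.

Import Order.TTheory GRing.Theory Num.Theory.
Import numFieldNormedType.Exports.

Local Open Scope classical_set_scope.
Local Open Scope ring_scope.

(** * Coordinates, continuity and real induction *)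

Lemma coord_le_norm (R : realType) d (v : 'rV[R]_d) i : `|v 0 i| <= `|v|.
Proof.
by rewrite [leRHS]/Num.norm /= mx_normrE; exact: (le_bigmax _ _ (0, i)).
Qed.

Lemma norm_le_coord (R : realType) d (v : 'rV[R]_d) e :
  0 <= e -> (forall i, `|v 0 i| <= e) -> `|v| <= e.
Proof.
move=> e0 ve; rewrite [leLHS]/Num.norm /= mx_normrE; apply: bigmax_le => //.
by move=> [j i] _ /=; rewrite ord1.
Qed.

Lemma coord_comp_continuous (R : realType) d (X : topologicalType)
    (z : X -> 'rV[R]_d) i : continuous z -> continuous (fun s => z s 0 i).
Proof.
by move=> cz s; exact: (cvg_comp _ _ (cz s) (@coord_continuous R 1 d 0 i (z s))).
Qed.

Lemma continuous_pairing (X Y Z : topologicalType) (f : X -> Y) (g : X -> Z) :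
  continuous f -> continuous g -> continuous (fun x => (f x, g x)).
Proof.
move=> cf cg x.
exact: (@cvg_pair _ _ _ (nbhs x) (nbhs (f x)) (nbhs (g x)) _ _ _ f g (cf x) (cg x)).
Qed.

Lemma within_comp_continuous (X Y Z : topologicalType) (A : set X) (f : X -> Y)
    (g : Z -> X) :
  {within A, continuous f} -> (forall z, A (g z)) -> continuous g ->
  continuous (f \o g).
Proof.
move=> /subspace_continuousP cf Ag cg z.
apply: (@cvg_comp _ _ _ g f _ (within A (nbhs (g z)))); last exact: cf.
move=> B /= wB.
have H : nbhs z [set y | A (g y) -> B (g y)] := cg z [set x | A x -> B x] wB.
by apply: (filterS (F := nbhs z) _ H) => y /=; apply; exact: Ag.
Qed.

Lemma cvg_rV (R : realType) d (I : Type) (U : set_system I) {UF : Filter U}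
    (f : I -> 'rV[R]_d) (l : 'rV[R]_d) (g : 'I_d -> I -> R) (m : 'I_d -> R) :
  (forall i n, f n 0 i = g i n) -> (forall i, l 0 i = m i) ->
  (forall i, g i n @[n --> U] --> m i) -> f n @[n --> U] --> l.
Proof.
move=> fg lm gm; apply/cvgrPdist_le => e e0.
have : \forall n \near U, forall i, `|m i - g i n| <= e.
  apply: filter_forall => i.
  by have /cvgrPdist_le := gm i; exact.
apply: filterS => n H; apply: norm_le_coord; first exact: ltW.
by move=> i; rewrite !mxE lm fg.
Qed.

(** The supremum of the times up to which [Q] holds throughout can neither be
    missed, by the left condition, nor be smaller than [T], by the right one. *)
Lemma real_induction (R : realType) (T : R) (Q : R -> Prop) :
  Q 0 ->
  (forall t, 0 < t -> t <= T -> (forall s, 0 <= s -> s < t -> Q s) -> Q t) ->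
  (forall t, 0 <= t -> t < T -> (forall s, 0 <= s -> s <= t -> Q s) ->
     exists2 h, 0 < h & forall s, t < s -> s < t + h -> s <= T -> Q s) ->
  forall t, 0 <= t -> t <= T -> Q t.
Proof.
move=> Q0 Qleft Qright t t0 tT.
have T0 : 0 <= T := le_trans t0 tT.
pose S := [set s | [/\ 0 <= s, s <= T & forall u, 0 <= u -> u <= s -> Q u]].
have S0 : S 0.
  split => // u u0 u1; suff -> : u = 0 by [].
  by apply/eqP; rewrite eq_le u1 u0.
have Sub : has_ubound S by exists T => u [].
have supS : has_sup S by split; [exists 0|].
pose c := sup S.
have c0 : 0 <= c by apply: ub_le_sup.
have cT : c <= T by apply: ge_sup; [exists 0|move=> u []].
have Qlt u : 0 <= u -> u < c -> Q u.
  move=> u0 uc; have [v [_ _ Sv] uv] := sup_gt (ex_intro _ _ S0) uc.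
  by apply: Sv => //; exact: ltW.
have Qc : Q c.
  have [->//|cn0] := eqVneq c 0.
  by apply: Qleft => //; rewrite lt_def cn0.
have Qle u : 0 <= u -> u <= c -> Q u.
  by move=> u0; rewrite le_eqVlt => /predU1P[->//|]; exact: Qlt.
have [tc|ct] := leP t c; first exact: Qle.
have [h h0 Qh] := Qright c c0 (lt_le_trans ct tT) Qle.
pose v := Num.min T (c + h / 2).
have cv : c < v by rewrite /v lt_min (lt_le_trans ct tT) /=; lra.
have vT : v <= T by rewrite /v ge_min lexx.
have Sv : S v.
  split => //; first lra.
  move=> u u0 uv; have [uc|cu] := leP u c; first exact: Qle.
  apply: Qh => //; last exact: le_trans uv vT.
  by apply: (le_lt_trans uv); rewrite /v gt_min; apply/orP; right; lra.
have : v <= c by apply: ub_le_sup.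
by rewrite leNgt cv.
Qed.

(** * Continuous convergence of families of paths *)

Section continuous_convergence.
Context (R : realType) (I : Type) (U : set_system I) {UF : ProperFilter U}.

(** On compact intervals and for a continuous limit this amounts to uniform
    convergence, but in this form it passes through compositions with
    continuous maps without any uniformity estimate. *)
Definition cts_cvg (W : topologicalType) (f : I -> R -> W) (g : R -> W) :=
  forall t, f p.1 p.2 @[p --> filter_prod U (nbhs t)] --> g t.

Lemma cts_cvg_pointwise (W : topologicalType) (f : I -> R -> W) (g : R -> W) t :
  cts_cvg f g -> f n t @[n --> U] --> g t.
Proof.
move=> fg; apply: cvg_trans (fg t) => A /= [[X Y] /= [UX nY] XY].
suff : U ((f^~ t) @^-1` A) by [].
apply: filterS UX => n Xn.
exact: (XY (n, t) (conj Xn (nbhs_singleton nY))).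
Qed.

Lemma cts_cvg_cst (W : topologicalType) (g : R -> W) :
  continuous g -> cts_cvg (fun=> g) g.
Proof.
by move=> cg t; exact: (cvg_comp _ _ (@cvg_snd _ _ U (nbhs t) _) (cg t)).
Qed.

Lemma cts_cvg_reparam (W : topologicalType) (f : I -> R -> W) (g : R -> W)
    (c : R -> R) :
  continuous c -> cts_cvg f g -> cts_cvg (fun n => f n \o c) (g \o c).
Proof.
move=> cc fg t.
have H : (p.1, c p.2) @[p --> filter_prod U (nbhs t)] -->
         filter_prod U (nbhs (c t)).
  apply: (@cvg_pair _ _ _ (filter_prod U (nbhs t)) U (nbhs (c t))).
    exact: (@cvg_fst _ _ U (nbhs t) _).
  exact: (cvg_comp _ _ (@cvg_snd _ _ U (nbhs t) _) (cc t)).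
exact: (cvg_comp _ _ H (fg (c t))).
Qed.

Lemma cts_cvg_comp2 (W1 W2 W : topologicalType) (f1 : I -> R -> W1) g1
    (f2 : I -> R -> W2) g2 (h : W1 * W2 -> W) :
  cts_cvg f1 g1 -> cts_cvg f2 g2 -> continuous h ->
  cts_cvg (fun n t => h (f1 n t, f2 n t)) (fun t => h (g1 t, g2 t)).
Proof.
move=> fg1 fg2 ch t; have /= cht := ch (g1 t, g2 t).
have pr := @cvg_pair _ _ _ (filter_prod U (nbhs t)) (nbhs (g1 t))
  (nbhs (g2 t)) _ _ _ _ _ (fg1 t) (fg2 t).
exact: (cvg_comp _ _ (pr _ _ _) cht).
Qed.

Lemma cts_cvg_comp (W1 W : topologicalType) (f1 : I -> R -> W1) g1
    (h : W1 -> W) :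
  cts_cvg f1 g1 -> continuous h ->
  cts_cvg (fun n t => h (f1 n t)) (fun t => h (g1 t)).
Proof. by move=> fg1 ch t; exact: (cvg_comp _ _ (fg1 t) (ch _)). Qed.

(** Compactness of the interval, as a near-covering property, turns the
    neighbourhoods at each time into a single event of the filter. *)
Lemma cts_cvg_uniform (W : topologicalType) (f : I -> R -> W) (g : R -> W)
    a b (O : set W) :
  cts_cvg f g -> (forall t, a <= t -> t <= b -> nbhs (g t) O) ->
  \forall n \near U, forall t, a <= t -> t <= b -> O (f n t).
Proof.
move=> fg gO.
have /compact_near_coveringP cov := @segment_compact R a b.
have /= := cov I U (fun n t => O (f n t)) _ _.
move=> /(_ _ _)/wrap[t|]; last first.
  by apply: filterS => n h t at_ tb; apply: h; rewrite /= in_itv /= at_.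
rewrite /= in_itv /= => /andP[ta tb].
have [[X Y] /= [UX nY] XY] := fg t _ (gO t ta tb).
exists (Y, X) => //= -[y x] /= [Yy Xx]; exact: (XY (x, y)).
Qed.

Lemma cts_cvg_continuous (W : topologicalType) (g : R -> W) :
  cts_cvg (fun=> g) g -> continuous g.
Proof.
move=> cg t A /= /(cg t)[[X Y] /= [UX nY] XY].
have [n Xn] := filter_ex UX.
suff : nbhs t (g @^-1` A) by [].
by apply: (filterS (F := nbhs t) _ nY) => s Ys; exact: (XY (n, s)).
Qed.

End continuous_convergence.

(** * Approximate primitives *)

Section approximate_primitive.
Context (R : realType) (V : normedModType R).

(** Increments of [z] over [[s, t]] are as close to those of a constant velocity
    [v] as [phi] is to [v] on [[s - dl, t]].  For [dl = 0] and continuous [phi]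
    this says that [z] is a primitive of [phi] on [[0, T]].  The lag [dl] lets
    Euler polygons qualify, whose velocity at a time is the value of [phi] at
    the preceding node. *)
Definition approx_primitive (T dl : R) (phi z : R -> V) := forall s t v e,
  0 <= s -> s <= t -> t <= T ->
  (forall u, s - dl <= u -> u <= t -> `|phi u - v| <= e) ->
  `|z t - z s - (t - s) *: v| <= e * (t - s).

(** The defining estimate is closed under pointwise limits of [z]; continuous
    convergence of [phi] supplies its hypothesis uniformly in time, also on the
    short stretch of length [dl n] to the left of [s]. *)
Lemma approx_primitive_limit (I : Type) (U : set_system I) {UF : ProperFilter U}
    T (dl : I -> R) (phi : I -> R -> V) (z : I -> R -> V) phi0 z0 :
  (forall e, 0 < e -> \forall n \near U, dl n < e) ->
  (\forall n \near U, approx_primitive T (dl n) (phi n) (z n)) ->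
  cts_cvg U phi phi0 -> (forall t, z n t @[n --> U] --> z0 t) ->
  approx_primitive T 0 phi0 z0.
Proof.
move=> dl0 prim cphi cz s t v e s0 st tT phi0v.
have {}phi0v u : s <= u -> u <= t -> `|phi0 u - v| <= e.
  by move=> su ut; apply: phi0v; rewrite ?subr0.
apply/ler_addgt0Pr => e' e'0.
pose e1 := e' / (1 + (t - s)).
have e10 : 0 < e1 by rewrite /e1 divr_gt0 //; lra.
pose O := [set x : V | `|x - v| <= e + e1].
have nO u : s <= u -> u <= t -> nbhs (phi0 u) O.
  move=> su ut; apply/nbhs_ballP; exists e1 => //= x.
  rewrite -ball_normE /= /O /= => /ltW h.
  have -> : x - v = (phi0 u - v) + (x - phi0 u) by rewrite [RHS]addrC addrA subrK.
  by rewrite (le_trans (ler_normD _ _)) // lerD ?phi0v // distrC.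
have main : \forall n \near U,
    `|z n t - z n s - (t - s) *: v| <= (e + e1) * (t - s).
  have [[X Y] /= [UX /nbhs_ballP[a /= a0 aY]] XY] := cphi s _ (nO s (lexx s) st).
  have nX : \forall n \near U, X n by [].
  near=> n.
  have Hn : approx_primitive T (dl n) (phi n) (z n) by near: n.
  apply: Hn => // u su ut.
  (* Times after [s] lie in a compact interval; earlier ones within [dl n] of [s]. *)
  have [/ltW us|su'] := ltP s u.
    suff : O (phi n u) by [].
    by move: u us ut {su}; near: n; exact: cts_cvg_uniform nO.
  apply: (XY (n, u)); split => /=; first by near: n.
  apply: aY; rewrite -ball_normE /= ger0_norm ?subr_ge0 //.
  have : dl n < a by near: n; exact: dl0.
  lra.
have : `|z0 t - z0 s - (t - s) *: v| <= (e + e1) * (t - s).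
  pose c := (e + e1) * (t - s).
  apply: (@closed_cvg I R U _ (fun n => `|z n t - z n s - (t - s) *: v|)
     (fun y => y <= c) (@closed_le R c) main).
  by apply: cvg_norm; apply: cvgB; [apply: cvgB; exact: cz|exact: cvg_cst].
move=> /le_trans; apply; rewrite mulrDl lerD2l /e1.
rewrite mulrAC ler_pdivrMr; last lra.
rewrite ler_pM2l //; lra.
Unshelve. all: by end_near. Qed.

Lemma approx_primitive_eq T T' (phi psi z : R -> V) :
  T' <= T -> (forall u, 0 <= u -> u <= T' -> phi u = psi u) ->
  approx_primitive T 0 phi z -> approx_primitive T' 0 psi z.
Proof.
move=> TT phipsi prim s t v e s0 st tT He; apply: prim => //.
  exact: le_trans TT.
move=> u su ut; rewrite phipsi; first exact: He.
  by move: su; rewrite subr0; exact: le_trans.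
exact: le_trans tT.
Qed.

Lemma approx_primitive_right T (phi z : R -> V) t e :
  approx_primitive T 0 phi z -> continuous phi -> 0 <= t -> t < T -> 0 < e ->
  exists2 h, 0 < h & forall s, t <= s -> s < t + h -> s <= T ->
    `|z s - z t - (s - t) *: phi t| <= e * (s - t).
Proof.
move=> prim cphi t0 tT e0.
have /cvgrPdist_le/(_ _ e0)/nbhs_ballP[h /= h0 hP] := cphi t.
exists h => // s ts sth sT; apply: prim => // u; rewrite subr0 => tu us.
rewrite distrC; apply: hP; rewrite -ball_normE /= ltr_norml; lra.
Qed.

Lemma approx_primitive_left T (phi z : R -> V) t e :
  approx_primitive T 0 phi z -> continuous phi -> 0 < t -> t <= T -> 0 < e ->
  exists2 h, 0 < h & forall s, 0 <= s -> t - h < s -> s <= t ->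
    `|z t - z s - (t - s) *: phi t| <= e * (t - s).
Proof.
move=> prim cphi t0 tT e0.
have /cvgrPdist_le/(_ _ e0)/nbhs_ballP[h /= h0 hP] := cphi t.
exists h => // s s0 sth sT; apply: prim => // u; rewrite subr0 => tu us.
rewrite distrC; apply: hP; rewrite -ball_normE /= ltr_norml; lra.
Qed.

End approximate_primitive.

(** * Compactness along an ultrafilter *)

Section ultrafilter_compactness.
Context (R : realType) (d : nat).
Context (I : Type) (U : set_system I) {UU : UltraFilter U}.

Lemma ultra_bounded_cvg (f : I -> 'rV[R]_d) (C : R) :
  (forall n, `|f n| <= C) -> exists l : 'rV[R]_d, f n @[n --> U] --> l.
Proof.
move=> fC.
have cK := @rV_compact R d (fun=> `[- C, C]%classic) (fun=> @segment_compact R _ _).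
set K := (X in compact X) in cK.
have UF : ProperFilter U by exact: ultra_proper.
have fU : UltraFilter (f @ U).
  apply: Build_UltraFilter => G GP fG; apply/seteqP; split => // A GA.
  have [//|UA] := in_ultra_setVsetC (f @^-1` A) UU.
  have : G (A `&` ~` A) by apply: filterI => //; exact: fG.
  by rewrite setICr => /filter_ex[].
have fK : (f @ U) K.
  suff : U (f @^-1` K) by [].
  apply: filterS (filterT : U setT) => n _ i /=.
  rewrite in_itv /= -ler_norml (le_trans _ (fC n)) //; exact: coord_le_norm.
move: cK; rewrite compact_ultra => /(_ _ fU fK)[l [_ fl]].
by exists l.
Qed.

Definition lipschitz_path (B : R) (z : R -> 'rV[R]_d) :=
  forall s t, `|z t - z s| <= B * `|t - s|.

Lemma lipschitz_path_continuous B z : lipschitz_path B z -> continuous z.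
Proof.
move=> zB t; apply/cvgrPdist_le => e e0.
have B0 : 0 <= B by have := zB 0 1; rewrite subr0 normr1 mulr1; exact: le_trans.
apply/nbhs_ballP; exists (e / (B + 1)) => /=; first by rewrite divr_gt0 //; lra.
move=> s /= ts.
apply: (le_trans (zB s t)); move: ts; rewrite ltr_pdivlMr; last lra.
by have := normr_ge0 (t - s); nra.
Qed.

(** The Arzela-Ascoli theorem without extraction of subsequences: an ultrafilter
    makes every bounded sequence converge, so the limit exists at each time, and
    the common Lipschitz constant upgrades pointwise to continuous
    convergence. *)
Lemma lipschitz_ultra_limit (B : R) (f : I -> R -> 'rV[R]_d) z0 :
  (forall n, lipschitz_path B (f n)) -> (forall n, f n 0 = z0) ->
  exists z, [/\ cts_cvg U f z, lipschitz_path B z & z 0 = z0].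
Proof.
move=> fB f0.
have UF : ProperFilter U by exact: ultra_proper.
have ex t : exists l : 'rV[R]_d, f n t @[n --> U] --> l.
  apply: (@ultra_bounded_cvg _ (`|z0| + B * `|t|)) => n.
  rewrite -(subrK z0 (f n t)) addrC (le_trans (ler_normD _ _)) // lerD2l.
  by have := fB n 0 t; rewrite subr0 f0.
have [z zP] := choice ex.
have zB : lipschitz_path B z.
  move=> s t; pose c := B * `|t - s|.
  apply: (@closed_cvg I R U _ (fun n => `|f n t - f n s|)
     (fun y => y <= c) (@closed_le R c)).
    by apply: nearW => n; exact: fB.
  by apply: cvg_norm; apply: cvgB; exact: zP.
have B0 : 0 <= B by have := zB 0 1; rewrite subr0 normr1 mulr1; exact: le_trans.
exists z; split => //; last first.
  have := zP 0; rewrite (_ : f ^~ 0 = cst z0); last by apply/funext => n; exact: f0.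
  move=> cz0; apply: (cvg_unique (@norm_hausdorff _ _) cz0); exact: cvg_cst.
move=> t; apply/cvgrPdist_le => e e0.
have e2 : 0 < e / 2 by rewrite divr_gt0.
have /cvgrPdist_le/(_ _ e2) H := zP t.
exists ([set n | `|z t - f n t| <= e / 2], ball t (e / 2 / (B + 1))) => /=.
  by split => //; apply: nbhsx_ballx; rewrite divr_gt0 //; lra.
move=> [n s] /= [h1]; rewrite -ball_normE /= ltr_pdivlMr; last lra.
move=> h2; have := fB n s t.
have -> : z t - f n s = (z t - f n t) + (f n t - f n s) by rewrite addrA subrK.
move=> h3; apply: (le_trans (ler_normD _ _)).
by have := normr_ge0 (t - s); nra.
Qed.

End ultrafilter_compactness.

(** * Euler polygons and the theorem of Peano *)

Section euler.
Context (R : realType) (V : normedModType R).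
Variables (Phi : R -> (R -> V) -> V) (z0 : V) (h : R).
Hypothesis h0 : 0 < h.

(** The time elapsed within one Euler step of length [a]; [ramp T] also serves
    as the projection of the time axis onto [[0, T]]. *)
Definition ramp (a t : R) : R := Num.max 0 (Num.min t a).

(** The polygon after [k] steps of length [h], as a path on the whole line: each
    step adds a ramp starting at its node, so that the earlier part of the path
    is kept and [Phi] can be evaluated at the unfinished polygon. *)
Fixpoint euler (k : nat) : R -> V :=
  if k is j.+1 then
    fun t => euler j t + ramp h (t - j%:R * h) *: Phi (j%:R * h) (euler j)
  else fun=> z0.

Lemma ramp_le0 a t : 0 <= a -> t <= 0 -> ramp a t = 0.
Proof. by move=> a0 t0; rewrite /ramp max_l // ge_min t0. Qed.

Lemma ramp_le a s t : s <= t -> ramp a s <= ramp a t.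
Proof.
move=> st; rewrite /ramp ge_max le_max lexx /= le_max; apply/orP.
case: (leP t a) => ta; case: (leP s a) => sa; right; lra.
Qed.

Lemma euler_start k t : t <= 0 -> euler k t = z0.
Proof.
move=> t0; elim: k => //= k ->; rewrite ramp_le0 ?scale0r ?addr0 ?(ltW h0) //.
have : 0 <= k%:R * h by rewrite mulr_ge0 // ltW.
lra.
Qed.

Lemma euler_stable j k t : (j <= k)%N -> t <= j%:R * h -> euler k t = euler j t.
Proof.
move=> jk tj; elim: k jk => [|k IH]; first by rewrite leqn0 => /eqP ->.
rewrite leq_eqVlt => /predU1P[<- //|]; rewrite ltnS => jk /=.
rewrite IH // ramp_le0 ?scale0r ?addr0 ?(ltW h0) //.
have : j%:R * h <= k%:R * h by rewrite ler_pM2r // ler_nat.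
lra.
Qed.

Lemma sum_ramp k t : \sum_(j < k) ramp h (t - j%:R * h) = ramp (k%:R * h) t.
Proof.
elim: k => [|k IH]; first by rewrite big_ord0 mul0r /ramp max_l // ge_min lexx orbT.
rewrite big_ord_recr /= IH /ramp mulrSr mulrDl mul1r.
have : 0 <= k%:R * h by rewrite mulr_ge0 // ltW.
have := ltW h0; move: (k%:R * h) => a h0' a0.
case: (leP t a) => ta; case: (leP (t - a) h) => tah; case: (leP t (a + h)) => tah';
  rewrite ?[Num.max _ _]maxEle; do ?[case: ifP]; lra.
Qed.

Lemma eulerE k t :
  euler k t = z0 + \sum_(j < k) ramp h (t - j%:R * h) *:
                                Phi (j%:R * h) (euler j).
Proof.
elim: k => [|k IH] /=; first by rewrite big_ord0 addr0.
by rewrite big_ord_recr /= IH addrA.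
Qed.

(** Between [s] and [t] only the steps whose interval [[j h, j h + h]] meets
    [[s, t]] contribute, with nonnegative weights that add up to the elapsed
    time. *)
Lemma euler_increment k s t v e : s <= t ->
  (forall j : 'I_k, s < j%:R * h + h -> j%:R * h < t ->
     `|Phi (j%:R * h) (euler j) - v| <= e) ->
  `|euler k t - euler k s - (ramp (k%:R * h) t - ramp (k%:R * h) s) *: v|
    <= e * (ramp (k%:R * h) t - ramp (k%:R * h) s).
Proof.
move=> st He; rewrite !eulerE -!sum_ramp opprD addrACA subrr add0r -!sumrB.
rewrite scaler_suml -sumrB mulr_sumr.
apply: (le_trans (ler_norm_sum _ _ _)); apply: ler_sum => j _.
rewrite -scalerBl -scalerBr normrZ.
have rst : ramp h (s - j%:R * h) <= ramp h (t - j%:R * h) by apply: ramp_le; lra.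
rewrite ger0_norm ?subr_ge0 // mulrC.
have [js|js] := leP (j%:R * h + h) s.
  have -> : ramp h (t - j%:R * h) = ramp h (s - j%:R * h).
    by rewrite /ramp !min_r //; lra.
  by rewrite subrr !mulr0.
have [jt|jt] := leP t (j%:R * h).
  by rewrite !ramp_le0 ?(ltW h0) //; [rewrite subrr !mulr0|lra|lra].
by rewrite ler_wpM2r ?subr_ge0 // He.
Qed.

Lemma ramp_lipschitz a s t : 0 <= a -> s <= t -> ramp a t - ramp a s <= t - s.
Proof.
move=> a0 st; rewrite /ramp.
by case: (leP t a) => ta; case: (leP s a) => sa; rewrite ?[Num.max _ _]maxEle;
  do ?[case: ifP]; lra.
Qed.

End euler.

Section peano.
Context (R : realType) (d : nat).
Let V : normedModType R := 'rV[R]_d.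
Variables (Phi : R -> (R -> V) -> V) (z0 : V) (T B : R).
Hypothesis T0 : 0 < T.
Hypothesis PhiB : forall t z, `|Phi t z| <= B.
Hypothesis Phi_causal : forall t z z', 0 <= t -> (forall u, u <= t -> z u = z' u) ->
  Phi t z = Phi t z'.
Hypothesis Phi_cts : forall (U : set_system nat) (z : nat -> R -> V) zoo,
  ProperFilter U -> (forall n, continuous (z n)) -> continuous zoo ->
  cts_cvg U z zoo -> cts_cvg U (fun n t => Phi t (z n)) (fun t => Phi t zoo).

(** Polygons of step [T / (n + 1)] are [B]-Lipschitz and, since [Phi] is causal,
    approximate primitives of [Phi] along themselves with lag one step; the
    limit along an ultrafilter is then an exact primitive. *)
Theorem peano : exists z : R -> V,
  [/\ z 0 = z0, lipschitz_path B z & approx_primitive T 0 (Phi ^~ z) z].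
Proof.
have [U [UU UN]] := ultraFilterLemma (F := \oo) _.
have UF : ProperFilter U by exact: ultra_proper.
pose h n := T / n.+1%:R.
have h0 n : 0 < h n by rewrite divr_gt0.
have hT n : n.+1%:R * h n = T by rewrite mulrCA divff ?mulr1 // pnatr_eq0.
pose p n := euler Phi z0 (h n) n.+1.
have pB n : lipschitz_path B (p n).
  have H s t : s <= t -> `|p n t - p n s| <= B * `|t - s|.
    move=> st; have T0' := ltW T0.
    have := @euler_increment _ _ Phi z0 _ (h0 n) n.+1 s t 0 B st.
    rewrite scaler0 subr0 => /(_ _)/wrap[j _ _|/le_trans]; first by rewrite subr0.
    apply; rewrite ler_wpM2l //.
      exact: le_trans (normr_ge0 _) (PhiB 0 (fun=> 0)).
    rewrite ger0_norm ?subr_ge0 // ramp_lipschitz // hT //.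
  move=> s t; have [st|/ltW ts] := leP s t; first exact: H.
  by rewrite distrC [X in B * X]distrC H.
have p0 n : p n 0 = z0 by apply: euler_start.
have [z [pz zB zz0]] := lipschitz_ultra_limit pB p0.
exists z; split => //.
apply: (@approx_primitive_limit _ _ _ U _ T h (fun n t => Phi t (p n)) p).
- move=> e e0; apply: UN.
  have : h n @[n --> \oo] --> (0 : R).
    rewrite -[0](mulr0 T); apply: cvgM; first exact: cvg_cst.
    exact: cvg_harmonic.
  move=> /cvgrPdist_lt/(_ _ e0); apply: filterS => n.
  by rewrite sub0r normrN ger0_norm // ltW.
- apply: nearW => n s t v e s0 st tT He.
  have := @euler_increment _ _ Phi z0 _ (h0 n) n.+1 s t v e st.
  rewrite hT.
  have rE u : 0 <= u -> u <= T -> ramp T u = u.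
    by move=> u0 uT; rewrite /ramp min_l // max_r.
  rewrite !rE //; try lra.
  apply => j sj jt.
  rewrite -(@Phi_causal _ (p n)); last 2 first.
  - by rewrite mulr_ge0 // ltW.
  - by move=> u uj; apply: euler_stable => //; exact: ltnW (ltn_ord j).
  by apply: He; lra.
- apply: Phi_cts => //; last exact: lipschitz_path_continuous zB.
  by move=> n; exact: lipschitz_path_continuous (pB n).
- by move=> t; exact: cts_cvg_pointwise pz.
Qed.

End peano.

(** The increment estimate on short intervals on either side of a time says that
    [z] has derivative [phi] there, and the fundamental theorem of calculus
    gives the integral equation. *)
Lemma approx_primitive_integral (R : realType) (d : nat) (T : R)
    (phi z : R -> 'rV[R]_d) t :
  approx_primitive T 0 phi z -> continuous phi -> continuous z ->
  0 <= t -> t <= T -> z t = z 0 + vint 0 t phi.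
Proof.
move=> prim cphi cz t0 tT; apply/eqP; rewrite addrC -subr_eq; apply/eqP.
apply/rowP => i; rewrite !mxE.
move: t0; rewrite le_eqVlt => /predU1P[<-|t0].
  by rewrite subrr set_itv1 Rintegral_set1.
have cphii := coord_comp_continuous (i := i) cphi.
have czi := coord_comp_continuous (i := i) cz.
have der s : 0 < s -> s < t -> is_derive s 1 (fun u => z u 0 i) (phi s 0 i).
  move=> s0 st.
  have cv : h^-1 *: (((fun u => z u 0 i) \o shift s) (h *: (1 : R)) - z s 0 i)
            @[h --> 0^'] --> phi s 0 i.
    apply/cvgrPdist_le => e e0.
    have sT : s < T by lra.
    have [hr hr0 Hr] := approx_primitive_right prim cphi (ltW s0) sT e0.
    have [hl hl0 Hl] := approx_primitive_left prim cphi s0 (ltW sT) e0.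
    pose m := Num.min (Num.min hr hl) (Num.min s (T - s)).
    have m0 : 0 < m by rewrite /m !lt_min hr0 hl0 s0; lra.
    apply/nbhs_ballP; exists m => //= h; rewrite -ball_normE /= sub0r normrN.
    rewrite /m !lt_min => /andP[/andP[h1 h2] /andP[h3 h4]] hn0.
    rewrite /shift /= [h *: 1]mulr1 (addrC h s).
    have key : `|z (s + h) - z s - h *: phi s| <= e * `|h|.
      have [hh|hh] := leP 0 h; [have nh := ger0_norm hh|have nh := ltr0_norm hh];
        rewrite nh in h1 h2 h3 h4 *.
        have := Hr (s + h); rewrite [s + h - s]addrC addKr => H; apply: H; lra.
      have := Hl (s + h); rewrite opprD addNKr.
      have -> : z s - z (s + h) - - h *: phi s = - (z (s + h) - z s - h *: phi s).
        by rewrite scaleNr opprK [RHS]opprD opprB opprK.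
      by rewrite normrN => H; apply: H; lra.
    have : `|(z (s + h) - z s - h *: phi s) 0 i| <= e * `|h|.
      exact: le_trans (coord_le_norm _ _) key.
    rewrite !mxE => key'.
    have -> : phi s 0 i - h^-1 *: (z (s + h) 0 i - z s 0 i) =
              - h^-1 * (z (s + h) 0 i - z s 0 i - h * phi s 0 i).
      by rewrite /GRing.scale /=; field.
    rewrite normrM normrN normfV mulrC ler_pdivrMr // normr_gt0 //.
  by split; [apply/cvg_ex; exists (phi s 0 i)|exact: cvg_lim].
rewrite /Rintegral (@continuous_FTC2 _ _ (fun u => z u 0 i)) //.
- exact: continuous_subspaceT.
- split => /=.
  + by move=> s; rewrite in_itv /= => /andP[s0 st]; have [] := der s s0 st.
  + exact/cvg_at_right_filter/czi.
  + exact/cvg_at_left_filter/czi.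
- move=> s; rewrite in_itv /= => /andP[s0 st].
  by rewrite derive1E; have [] := der s s0 st.
Qed.

(** * Histories and segments *)

Section histories.
Context (R : realType) (r : {posnum R}) (d : nat).
Local Notation hist := (history r d).

Lemma hist_dist_le (eta eta' : hist) c :
  (forall u, `|eta u - eta' u| <= c) -> hist_dist eta eta' <= c.
Proof.
move=> h; apply: ge_sup; first by exists `|eta (now r) - eta' (now r)|, (now r).
by move=> _ [u _ <-].
Qed.

Lemma delay_itvP (u : delay_itv r) : - r%:num <= \val u <= 0.
Proof. by have := valP u; rewrite inE /delay_itv /= in_itv. Qed.

Lemma segmentE (x : R -> 'rV[R]_d) s (u : delay_itv r) :
  continuous x -> segment r x s u = x (s + \val u).
Proof.
move=> cx.
have cxs : continuous (fun u : delay_itv r => x (s + \val u)).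
  have cval : continuous (set_val : delay_itv r -> R) by exact: initial_continuous.
  move=> v; apply: (@cvg_comp _ _ _ (fun v : delay_itv r => s + \val v) x _
    (nbhs (s + \val v))).
    exact: (cvgD (cvg_cst s) (cval v)).
  exact: cx.
have : [set eta : hist | forall u, eta u = x (s + \val u)] (mkcts cxs : hist).
  by move=> v.
by move=> H; have := xgetPex (hist_cst r 0) (ex_intro _ _ H); apply.
Qed.

Lemma eq_segment (x y : R -> 'rV[R]_d) s :
  (forall u, s - r%:num <= u -> u <= s -> x u = y u) ->
  segment r x s = segment r y s.
Proof.
move=> xy; rewrite /segment; congr (xget _ _).
have E (u : delay_itv r) : x (s + \val u) = y (s + \val u).
  by have /andP[u1 u2] := delay_itvP u; apply: xy; lra.
by apply/seteqP; split => eta /= H u; rewrite H E.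
Qed.

(** The distance of segments is a supremum over the delay interval, whose
    compactness makes the convergence of the values uniform. *)
Lemma segment_cts_cvg (I : Type) (U : set_system I) {UF : ProperFilter U}
    (x : I -> R -> 'rV[R]_d) y :
  (forall n, continuous (x n)) -> continuous y -> cts_cvg U x y ->
  cts_cvg U (fun n t => segment r (x n) t) (segment r y).
Proof.
move=> cx cy xy t; apply/cvg_ballP => e e0.
have e2 : 0 < e / 2 by rewrite divr_gt0.
have e4 : 0 < e / 4 by rewrite divr_gt0.
have /compact_near_coveringP cov := @segment_compact R (- r%:num) 0.
have /= := cov _ (filter_prod U (nbhs t))
  (fun p u => `|y (t + u) - x p.1 (p.2 + u)| <= e / 2) _ _.
move=> /(_ _ _)/wrap[u _|]; last first.
  apply: filterS => -[n s] /= h; rewrite /ball /=.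
  apply: (le_lt_trans (@hist_dist_le _ _ (e / 2) _)); last lra.
  move=> u; rewrite !segmentE //; apply: h => /=.
  by rewrite in_itv /= delay_itvP.
have /cvgrPdist_le/(_ _ e4) := xy (t + u).
move=> [[X Y] /= [UX /nbhs_ballP[h /= h0 hY]] XY].
have /cvgrPdist_le/(_ _ e4)/nbhs_ballP[k /= k0 kP] := cy (t + u).
have h2 : 0 < h / 2 by rewrite divr_gt0.
exists (ball u (Num.min k (h / 2)), X `*` ball t (h / 2)) => /=.
  split; first by apply: nbhsx_ballx; rewrite lt_min k0.
  by exists (X, ball t (h / 2)) => //=; split => //; exact: nbhsx_ballx.
move=> [u' [n s]] /= [+ [Xn]]; rewrite -!ball_normE /= lt_min => /andP[uk uh] sh.
have l1 : `|y (t + u) - y (t + u')| <= e / 4.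
  by apply: kP; rewrite -ball_normE /= opprD addrACA subrr add0r.
have l2 : `|y (t + u) - x n (s + u')| <= e / 4.
  apply: (XY (n, s + u')); split => //; apply: hY; rewrite -ball_normE /=.
  by rewrite opprD addrACA (le_lt_trans (ler_normD _ _)) //; lra.
have -> : y (t + u') - x n (s + u') =
   (y (t + u) - x n (s + u')) - (y (t + u) - y (t + u')).
  by rewrite opprB [RHS]addrC addrA subrK.
by rewrite (le_trans (ler_normB _ _)) //; lra.
Qed.

Definition delay_clamp (t : R) : R := Num.max (- r%:num) (Num.min t 0).

Lemma delay_clampP t : delay_clamp t \in delay_itv r.
Proof.
rewrite inE /delay_itv /= in_itv /= /delay_clamp le_max lexx /= ge_max oppr_le0.
by rewrite ltW //= ge_min lexx orbT.
Qed.

(** Being constant outside [[-r, 0]], this extension can be added to a path that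
    starts at time 0 without any gluing of continuous functions. *)
Definition hist_ext (eta : hist) (t : R) : 'rV[R]_d :=
  eta (exist _ (delay_clamp t) (delay_clampP t)).

Lemma hist_ext_continuous eta : continuous (hist_ext eta).
Proof.
pose c t : delay_itv r := exist _ (delay_clamp t) (delay_clampP t).
have cc : continuous c.
  apply: continuous_comp_initial => t /=.
  suff : {for t, continuous
      ((fun=> - r%:num : R^o) \max (id \min (fun=> 0 : R^o)))} by [].
  apply: continuous_max; first exact: cvg_cst.
  by apply: continuous_min; [exact: cvg_id|exact: cvg_cst].
by move=> t; apply: (@cvg_comp _ _ _ c eta _ _ _ (cc t)); exact: cts_fun.
Qed.

Lemma hist_ext_delay eta (u : delay_itv r) : hist_ext eta (\val u) = eta u.
Proof.
congr (eta _); apply: val_inj => /=.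
by have /andP[u1 u2] := delay_itvP u; rewrite /delay_clamp min_l // max_r.
Qed.

Lemma hist_ext_ge0 eta t : 0 <= t -> hist_ext eta t = eta (now r).
Proof.
move=> t0; congr (eta _); apply: val_inj => /=.
by rewrite /delay_clamp min_r // max_r // oppr_le0.
Qed.

End histories.

(** * Componentwise maps and their Jacobians *)

Section componentwise_maps.
Context (R : realType) (d : nat).
Implicit Types (f : 'rV[R]_d -> 'rV[R]_d) (v z : 'rV[R]_d).

Lemma diff_idE z : 'd id z = id :> ('rV[R]_d -> 'rV[R]_d).
Proof. by have D := is_diff_id z; rewrite diff_val. Qed.

Lemma jacobian_quotient f z v i : differentiable f z ->
  h^-1 * (f (h *: v + z) 0 i - f z 0 i) @[h --> 0^'] --> (v *m 'J f z) 0 i.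
Proof.
move=> df; have -> : v *m 'J f z = 'd f z v by rewrite mul_rV_lin1.
have := @diff_derivable _ _ _ f z v df.
rewrite /derivable => /cvg_ex[l hl].
have E : 'd f z v = l by rewrite -deriveE //; apply: cvg_lim.
rewrite E; have := cvg_comp _ _ hl (@coord_continuous R 1 d 0 i l).
apply: cvg_trans; apply: near_eq_cvg; near=> h.
by rewrite /= !mxE.
Unshelve. all: by end_near. Qed.

Lemma jacobian_row f z k i : 'J f z k i = ((delta_mx 0 k : 'rV[R]_d) *m 'J f z) 0 i.
Proof.
rewrite [RHS]mxE (bigD1 k) //= [delta_mx _ _ _ _]mxE !eqxx mul1r big1 ?addr0 // => j jk.
by rewrite [delta_mx _ _ _ _]mxE (negbTE jk) andbF mul0r.
Qed.

(** Coordinate [i] of [f] is constant in the other directions, so its difference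
    quotients along them vanish. *)
Lemma componentwise_jacobian f z v i : componentwise f -> differentiable f z ->
  (v *m 'J f z) 0 i = v 0 i * 'J f z i i.
Proof.
move=> cf df.
rewrite mxE (bigD1 i) //= big1 ?addr0 // => k ki.
suff -> : 'J f z k i = 0 by rewrite mulr0.
rewrite jacobian_row.
have := @jacobian_quotient f z (delta_mx 0 k) i df.
have E : (fun h : R => h^-1 * (f (h *: delta_mx 0 k + z) 0 i - f z 0 i)) = cst 0.
  apply/funext => h; rewrite (cf i (h *: delta_mx 0 k + z) z) ?subrr ?mulr0 //.
  by rewrite !mxE eqxx eq_sym (negbTE ki) mulr0 add0r.
rewrite E => h1; apply: (cvg_unique (@norm_hausdorff _ R) h1).
exact: cvg_cst.
Qed.

Lemma componentwise_jacobian_local f z z' i : componentwise f ->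
  differentiable f z -> differentiable f z' -> z 0 i = z' 0 i ->
  'J f z i i = 'J f z' i i.
Proof.
move=> cf df df' zi.
rewrite [LHS]jacobian_row [RHS]jacobian_row.
have h1 := @jacobian_quotient f z (delta_mx 0 i) i df.
have h2 := @jacobian_quotient f z' (delta_mx 0 i) i df'.
apply: (cvg_unique (@norm_hausdorff _ R) h1).
apply: cvg_trans h2; apply: near_eq_cvg; near=> h.
rewrite (cf i z z') // (cf i (h *: delta_mx 0 i + z) (h *: delta_mx 0 i + z')) //.
by rewrite !mxE zi.
Unshelve. all: by end_near. Qed.

Lemma C1_diffeomorphism_jacobian f z : C1_diffeomorphism f ->
  'J f z \in unitmx.
Proof.
move=> [g [fK gK [df _] [dg _]]].
have E v : v *m ('J f z *m 'J g (f z)) = v.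
  rewrite mulmxA !mul_rV_lin1.
  have C := diff_comp (df z) (dg (f z)).
  have gf : g \o f = id by apply/funext => y /=; rewrite fK.
  rewrite gf in C.
  have Did := congr1 (fun h : 'rV_d -> 'rV_d => h v) (diff_idE z).
  have Cv := congr1 (fun h : 'rV_d -> 'rV_d => h v) C.
  exact (etrans (esym Cv) Did).
have J1 : 'J f z *m 'J g (f z) = 1%:M.
  by apply/row_matrixP => i; rewrite [LHS]rowE E [RHS]rowE mulmx1.
have unit_of (A B : 'M[R]_d) : A *m B = 1%:M -> A \in unitmx.
  by case/mulmx1_unit.
exact: unit_of J1.
Qed.

(** For a diagonal invertible matrix no diagonal entry can vanish. *)
Lemma componentwise_jacobian_neq0 f z i : componentwise f ->
  C1_diffeomorphism f -> 'J f z i i != 0.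
Proof.
move=> cf Cf; have [g [_ _ [df _] _]] := Cf.
have uJ := C1_diffeomorphism_jacobian z Cf.
have := @componentwise_jacobian f z (delta_mx 0 i *m invmx ('J f z)) i cf (df z).
rewrite -mulmxA mulVmx // mulmx1 mxE !eqxx /= => E.
by apply/eqP => J0; move: E; rewrite J0 mulr0 => /eqP; rewrite oner_eq0.
Qed.

Lemma componentwise_invmx f z v : componentwise f -> C1_diffeomorphism f ->
  v *m invmx ('J f z) = \row_i (v 0 i / 'J f z i i).
Proof.
move=> cf Cf; have [g [_ _ [df _] _]] := Cf.
have uJ := C1_diffeomorphism_jacobian z Cf.
apply/rowP => i; rewrite mxE.
have := @componentwise_jacobian f z (v *m invmx ('J f z)) i cf (df z).
rewrite -mulmxA mulVmx // mulmx1 => ->.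
by rewrite mulfK // componentwise_jacobian_neq0.
Qed.

(** Replacing coordinate [i] of [z] by that of [z'] leaves [f z] unchanged, so by
    injectivity the replacement changes nothing. *)
Lemma componentwise_injective f z z' i : componentwise f -> injective f ->
  f z 0 i = f z' 0 i -> z 0 i = z' 0 i.
Proof.
move=> cf jf fi.
pose y := \row_k (if k == i then z' 0 i else z 0 k).
suff : y = z by move=> <-; rewrite mxE eqxx.
apply: jf; apply/rowP => k; have [->|ki] := eqVneq k i.
  by rewrite fi; apply: cf; rewrite mxE eqxx.
by apply: cf; rewrite mxE (negbTE ki).
Qed.

End componentwise_maps.

Lemma IVT_positive (R : realType) (f : R -> R) t : continuous f -> 0 <= t ->
  0 < f 0 -> (forall s, 0 <= s -> f s != 0) -> 0 < f t.
Proof.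
move=> cf t0 f0 fn0; rewrite ltNge; apply/negP => ft.
have cfs : {within `[0, t], continuous f} by exact: continuous_subspaceT.
have := @IVT R f 0 t 0 t0 cfs; rewrite min_r ?max_l; try lra.
rewrite ft (ltW f0) => /(_ isT)[c].
by rewrite in_itv /= => /andP[c0 _] /eqP; rewrite (negbTE (fn0 c c0)).
Qed.

(** Near [t] the path [f o z] moves with velocity [phi *m J] up to an error that
    is small compared with the elapsed time; if all velocities in a ball around
    this one point into [D], the path enters [D] for a while. *)
Lemma inward_path (R : realType) (d : nat) (f : 'rV[R]_d -> 'rV[R]_d)
    (D : set 'rV[R]_d) (z : R -> 'rV[R]_d) (t T : R) (phi : 'rV[R]_d) :
  componentwise f -> differentiable f (z t) ->
  (forall e, 0 < e -> exists2 h, 0 < h &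
     forall s, t <= s -> s < t + h -> s <= T ->
     `|z s - z t - (s - t) *: phi| <= e * (s - t)) ->
  (exists2 a, 0 < a & forall h u, 0 < h -> h <= a -> `|u| <= a ->
     D (f (z t) + h *: (phi *m 'J f (z t)) + h *: u)) ->
  exists2 h, 0 < h & forall s, t < s -> s < t + h -> s <= T -> D (f (z s)).
Proof.
move=> cf dz0 dz [a a0 aD].
set J := 'J f (z t) in aD *.
pose C := `|J|; have C0 : 0 <= C by exact: normr_ge0.
have JC i : `|J i i| <= C.
  rewrite /C [leRHS]/Num.norm /= mx_normrE; exact: (le_bigmax _ _ (i, i)).
have phi0 : 0 <= `|phi| by [].
(* Half of the admissible error [a] is spent on the velocity of [z], amplified
   by the Jacobian, and half on the linearization of [f]. *)
pose e := Num.min 1 (a / (2 * (C + 1))).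
have e0 : 0 < e by rewrite lt_min ltr01 divr_gt0 //; lra.
have eC : e * C <= a / 2.
  have : e <= a / (2 * (C + 1)) by rewrite ge_min lexx orbT.
  rewrite ler_pdivlMr; last lra.
  by nra.
pose e' := a / (2 * (`|phi| + 1)).
have e'0 : 0 < e' by rewrite divr_gt0 //; lra.
have e'phi : e' * (`|phi| + 1) = a / 2.
  rewrite /e'; field; lra.
have [h h0 hz] := dz e e0.
have [_ /eqaddoP/(_ _ e'0)] := iffLR (diff_locallyP (z t) f) dz0.
move=> /nbhs_ballP[k /= k0 kP].
exists (Num.min (Num.min h a) (k / (`|phi| + 1))).
  by rewrite !lt_min h0 a0 divr_gt0 //; lra.
move=> s ts; rewrite -ltrBlDl !lt_min => /andP[/andP[sh sa] sk] sT.
move: sk; rewrite ltr_pdivlMr => [sk|]; last lra.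
have st0 : 0 < s - t by lra.
have zs : `|z s - z t - (s - t) *: phi| <= e * (s - t) by apply: hz => //; lra.
have zn : `|z s - z t| <= (`|phi| + 1) * (s - t).
  rewrite -(subrK ((s - t) *: phi) (z s - z t)) (le_trans (ler_normD _ _)) //.
  rewrite normrZ (ger0_norm (ltW st0)).
  have : e <= 1 by rewrite ge_min lexx.
  by nra.
have Hf : `|f ((z s - z t) + z t) - (f (z t) + 'd f (z t) (z s - z t))|
    <= e' * `|z s - z t|.
  apply: (kP (z s - z t)); rewrite -ball_normE /= sub0r normrN; nra.
rewrite subrK in Hf.
pose u := (s - t)^-1 *: (f (z s) - f (z t)) - phi *m J.
have -> : f (z s) = f (z t) + (s - t) *: (phi *m J) + (s - t) *: u.
  rewrite -addrA -scalerDr /u [X in _ *: X]addrC subrK scalerA divff; last lra.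
  by rewrite scale1r addrC subrK.
apply: aD => //; first exact: ltW.
have mulJ (w : 'rV[R]_d) : `|w *m J| <= `|w| * C.
  apply: norm_le_coord => [|i]; first exact: mulr_ge0.
  rewrite componentwise_jacobian // normrM ler_pM //; exact: coord_le_norm.
have Ju w : 'd f (z t) w = w *m J by rewrite mul_rV_lin1.
have -> : u = (s - t)^-1 *: ((f (z s) - (f (z t) + 'd f (z t) (z s - z t)))
                + (z s - z t - (s - t) *: phi) *m J).
  have ZJ : ((s - t) *: phi) *m J = (s - t) *: (phi *m J).
    exact: (esym (scalemxAl _ _ _)).
  have BJ : (z s - z t - (s - t) *: phi) *m J =
            (z s - z t) *m J - (s - t) *: (phi *m J).
    by rewrite -ZJ; exact: mulmxBl.
  rewrite Ju BJ opprD addrA addrA subrK scalerBr scalerA mulVf.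
    by rewrite scale1r.
  lra.
rewrite normrZ normfV (ger0_norm (ltW st0)) mulrC ler_pdivrMr //.
apply: (le_trans (ler_normD _ _)).
have := mulJ (z s - z t - (s - t) *: phi).
have := normr_ge0 (z s - z t - (s - t) *: phi).
nra.
Qed.

(** * Inward drifts *)

Lemma convex_set_segment (R : realType) d (D : set 'rV[R]_d) x y (t : R) :
  convex_set (D : set (convex_lmodType 'rV[R]_d)) -> D x -> D y ->
  0 <= t -> t <= 1 -> D (t *: x + (1 - t) *: y).
Proof.
move=> cD Dx Dy t0 t1.
have t01 : Itv.spec (@Itv.num_sem R) (Itv.Real `[0%Z, 1%Z]) t.
  by rewrite /Itv.num_sem /= num_real /= in_itv /= t0 t1.
by have := cD x y (Itv.mk t01); rewrite !inE => /(_ Dx Dy).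
Qed.

(** The approximations [Heps] point into [D] but only with a margin that depends
    on their index.  A pull of strength [eps] towards an interior point [p]
    absorbs the difference between [H] and a close [Heps]: the displaced point
    is a convex combination of a point of [D] reached with [Heps] and a point
    near [p]. *)
Lemma inward_perturbation (R : realType) (r : {posnum R}) d (D : set 'rV[R]_d)
    (dT : measure_display) (T : measurableType dT) (F : R -> set (set T))
    (Psi : R -> R -> 'rV[R]_d -> T -> 'rV[R]_d)
    (H : R -> history r d -> T -> 'rV[R]_d) b w t eta p eps :
  convex_set (D : set (convex_lmodType 'rV[R]_d)) ->
  inward_approximation F Psi D H b ->
  0 <= t -> hist_in D eta -> interior D p -> 0 < eps ->
  exists2 a, 0 < a & forall h u, 0 < h -> h <= a -> `|u| <= a ->
    D (eta (now r) + h *: (H t eta w + eps *: (p - eta (now r))) + h *: u).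
Proof.
move=> cD [eps0 eps00 [Heps fam]] t0 Deta /nbhs_ballP[rho /= rho0 rhoD] ep0.
have er : 0 < eps * rho / 4 by rewrite divr_gt0 ?mulr_gt0.
have /cvgrPdist_le/(_ _ er) := inward_limit fam (w := w) t0 Deta.
move=> [k /= k0 kP].
pose e := Num.min (k / 2) eps0.
have e0 : 0 < e by rewrite lt_min eps00 divr_gt0.
have ee0 : e <= eps0 by rewrite ge_min lexx orbT.
have ek : e <= k / 2 by rewrite ge_min lexx.
have HH : `|H t eta w - Heps e t eta w| <= eps * rho / 4.
  by apply: kP => //=; rewrite sub0r normrN gtr0_norm //; lra.
have [a0 a00 aD] := inward_pointing fam w t0 Deta e0 ee0.
set X := eta (now r) in aD *; set He := Heps e t eta w in HH aD.
pose K := `|He|; have K0 : 0 <= K by exact: normr_ge0.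
(* The three last terms keep [u] small, make [eps * h] a convex weight, and
   bound the displacement [h * K] of the point [q] below. *)
pose a := Num.min (Num.min a0 (eps * rho / 4))
                  (Num.min (1 / eps) (rho / (4 * (K + 1)))).
have a_gt0 : 0 < a by rewrite !lt_min a00 er !divr_gt0 //; lra.
exists a => // h u h0; rewrite [h <= a]le_min => /andP[].
rewrite le_min => /andP[ha0 _]; rewrite le_min => /andP[hk hK].
rewrite [_ <= a]le_min => /andP[]; rewrite le_min => /andP[_ ur] _.
have hk1 : eps * h <= 1 by move: hk; rewrite ler_pdivlMr // mulrC.
have hKr : h * (K + 1) <= rho / 4.
  by move: hK; rewrite ler_pdivlMr; [lra|lra].
have Dx' : D (X + h *: He).
  by have := aD h 0 h0 ha0; rewrite normr0 scaler0 addr0; apply; exact: ltW.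
pose q := p + h *: He + eps^-1 *: (H t eta w - He + u).
have Dq : D q.
  apply: rhoD; rewrite -ball_normE /= distrC.
  have -> : q - p = h *: He + eps^-1 *: (H t eta w - He + u).
    by rewrite /q addrC !addrA addNr add0r.
  apply: (le_lt_trans (ler_normD _ _)); rewrite !normrZ.
  rewrite (gtr0_norm h0) (gtr0_norm (_ : 0 < eps^-1)) ?invr_gt0 //.
  have : eps^-1 * `|H t eta w - He + u| <= rho / 2.
    rewrite mulrC ler_pdivrMr // (le_trans (ler_normD _ _)) //.
    by move: HH ur; lra.
  by rewrite -/K; nra.
have := convex_set_segment cD Dq Dx' (ltW (mulr_gt0 ep0 h0)) hk1.
congr (D _); apply/rowP => i; rewrite !mxE; field; exact: lt0r_neq0.
Qed.

(** * The driving flow at one sample point *)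

Section driving_flow.
Context (R : realType) (d : nat) (D : set 'rV[R]_d).
Context (dT : measure_display) (T : measurableType dT) (P : probability T R).
Context (F : R -> set (set T)).
Context (M b : R -> 'rV[R]_d -> T -> 'rV[R]_d).
Context (Psi : R -> R -> 'rV[R]_d -> T -> 'rV[R]_d) (w : T).
Hypothesis flow : generated_flow P F M b Psi.
Hypothesis flowD : forall s t w, 0 <= s -> s < t ->
  (fun x => Psi s t x w) @` D = D.
Variable tmax : R.
Hypothesis tmax0 : 0 < tmax.

(** Time is projected onto [[0, tmax]], so that joint continuity on nonnegative
    times becomes continuity everywhere. *)
Definition flow_map (t : R) (z : 'rV[R]_d) := Psi 0 (ramp tmax t) z w.

(** The derivative of coordinate [i] of the flow, that is, the factor between
    velocities in flow coordinates and in the original ones. *)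
Definition flow_rate (t : R) (z : 'rV[R]_d) (i : 'I_d) : R :=
  'J (fun x => Psi 0 (ramp tmax t) x w) z i i.

Let ramp0 t : 0 <= ramp tmax t.
Proof. by rewrite /ramp le_max lexx. Qed.

Lemma ramp_id t : 0 <= t -> t <= tmax -> ramp tmax t = t.
Proof. by move=> t0 tT; rewrite /ramp min_l // max_r. Qed.

Lemma ramp_continuous a : continuous (ramp a : R -> R).
Proof.
move=> t; suff : {for t, continuous
    ((fun=> 0 : R^o) \max (id \min (fun=> a : R^o)))} by [].
apply: continuous_max; first exact: cvg_cst.
by apply: continuous_min; [exact: cvg_id|exact: cvg_cst].
Qed.

Let time_continuous :
  continuous (fun p : R * 'rV[R]_d => ((0 : R, ramp tmax p.1), p.2)).
Proof.
apply: continuous_pairing; last by move=> p; exact: cvg_snd.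
apply: continuous_pairing; first by move=> p; exact: cvg_cst.
move=> p; apply: (@continuous_comp _ _ _ fst (ramp tmax)); first exact: cvg_fst.
exact: ramp_continuous.
Qed.

Lemma flow_map_continuous : continuous (fun p => flow_map p.1 p.2).
Proof.
apply: (within_comp_continuous (@flow_continuous _ _ _ _ _ _ _ _ _ flow w) _ time_continuous).
by move=> z /=.
Qed.

Lemma flow_rate_continuous i : continuous (fun p => flow_rate p.1 p.2 i).
Proof.
have := within_comp_continuous (@flow_jacobian_continuous _ _ _ _ _ _ _ _ _ flow w) _ time_continuous.
move=> /(_ _)/wrap[z //=|cJ] p.
exact: (cvg_comp _ _ (cJ p) (@coord_continuous R d d i i _)).
Qed.

Lemma flow_map_diffeo t : C1_diffeomorphism (flow_map t).
Proof. exact: (flow_diffeomorphism flow). Qed.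

Lemma flow_map_componentwise t : componentwise (flow_map t).
Proof. exact: (flow_componentwise flow). Qed.

Lemma flow_map_differentiable t z : differentiable (flow_map t) z.
Proof. by have [g [_ _ [dg _] _]] := flow_map_diffeo t. Qed.

Lemma flow_map_inj t : injective (flow_map t).
Proof. by have [g [fK _ _ _]] := flow_map_diffeo t; exact: can_inj fK. Qed.

Lemma flow_map_le0 t z : t <= 0 -> flow_map t z = z.
Proof.
by move=> t0; rewrite /flow_map ramp_le0 ?(ltW tmax0) // (flow_id flow).
Qed.

Lemma flow_map_in t z : D (flow_map t z) <-> D z.
Proof.
rewrite /flow_map; have := ramp0 t; rewrite le_eqVlt => /predU1P[<-|t0].
  by rewrite (flow_id flow).
split => [|Dz]; last first.
  rewrite -(flowD w (lexx 0) t0); by exists z.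
rewrite -{1}(flowD w (lexx 0) t0) => -[y Dy].
by move=> /(@flow_map_inj t) <-.
Qed.

Let section_continuous (V : topologicalType) (f : R * 'rV[R]_d -> V) z :
  continuous f -> continuous (fun t => f (t, z)).
Proof.
move=> cf t; have cp : continuous (fun t : R => (t, z)).
  by apply: continuous_pairing => x; [exact: cvg_id|exact: cvg_cst].
exact: (cvg_comp _ _ (cp t) (cf (t, z))).
Qed.

(** The rate is continuous in time, never vanishes, and is 1 at time 0. *)
Lemma flow_rate_gt0 t z i : 0 < flow_rate t z i.
Proof.
rewrite /flow_rate; have {1}-> : ramp tmax t = ramp tmax (ramp tmax t).
  by rewrite [RHS]ramp_id // /ramp ge_max (ltW tmax0) ge_min lexx orbT.
apply: (@IVT_positive R (fun s => flow_rate s z i)) => //.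
- by have := section_continuous (z := z) (@flow_rate_continuous i).
- rewrite /flow_rate jacobian_row mul_rV_lin1 ramp_le0 ?(ltW tmax0) //.
  have -> : (fun x => Psi 0 0 x w) = id.
    by apply/funext => x; rewrite (flow_id flow).
  by rewrite diff_idE mxE !eqxx.
- move=> s _; apply: componentwise_jacobian_neq0.
    exact: flow_map_componentwise.
  exact: flow_map_diffeo.
Qed.

Lemma flow_rate_local t (z z' : 'rV[R]_d) i : z 0 i = z' 0 i ->
  flow_rate t z i = flow_rate t z' i.
Proof.
apply: componentwise_jacobian_local; first exact: flow_map_componentwise.
all: exact: flow_map_differentiable.
Qed.

(** The difference of two distinct values of a coordinate is continuous in time
    and, the flow being componentwise and injective, cannot vanish. *)
Lemma flow_map_le t (z z' : 'rV[R]_d) i : z 0 i <= z' 0 i ->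
  flow_map t z 0 i <= flow_map t z' 0 i.
Proof.
rewrite le_eqVlt => /predU1P[zi|zi].
  by rewrite (flow_map_componentwise t zi).
have [t0|/ltW t0] := leP t 0; first by rewrite !flow_map_le0 // ltW.
rewrite -subr_ge0 ltW //.
have ci x : continuous (fun s => flow_map s x 0 i).
  have cx := section_continuous (z := x) flow_map_continuous.
  move=> s; exact: (cvg_comp _ _ (cx s) (@coord_continuous R 1 d 0 i _)).
apply: (@IVT_positive R (fun s => flow_map s z' 0 i - flow_map s z 0 i)) => //.
- by move=> s; apply: cvgB; exact: ci.
- by rewrite !flow_map_le0 // subr_gt0.
move=> s _; rewrite subr_eq0; apply/eqP => E; move: zi.
have := componentwise_injective (@flow_map_componentwise s) (@flow_map_inj s) E.
by move=> ->; rewrite ltxx.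
Qed.

Lemma flow_inverse_map t z : flow_inverse Psi (ramp tmax t) (flow_map t z) w = z.
Proof.
rewrite /flow_inverse /flow_map; apply: (@pinvKV _ _ _ setT); last by rewrite inE.
by move=> x y _ _; exact: (@flow_map_inj t).
Qed.

(** By the composition law the flow from [t] back to 0 inverts the flow from 0 to
    [t]; unlike an abstract inverse it is visibly jointly continuous. *)
Definition flow_back (t : R) (x : 'rV[R]_d) := Psi (ramp tmax t) 0 x w.

Lemma flow_backK t : cancel (flow_back t) (flow_map t).
Proof.
move=> z; rewrite /flow_back /flow_map -(flow_compose flow) //.
by rewrite (flow_id flow).
Qed.

Lemma flow_back_continuous : continuous (fun p => flow_back p.1 p.2).
Proof.
have c : continuous (fun p : R * 'rV[R]_d => ((ramp tmax p.1, 0 : R), p.2)).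
  apply: continuous_pairing; last by move=> p; exact: cvg_snd.
  apply: continuous_pairing; last by move=> p; exact: cvg_cst.
  move=> p; apply: (@continuous_comp _ _ _ fst (ramp tmax)); first exact: cvg_fst.
exact: ramp_continuous.
by apply: (within_comp_continuous (@flow_continuous _ _ _ _ _ _ _ _ _ flow w) _ c) => z /=.
Qed.

End driving_flow.

(** * The equation in flow coordinates *)

Section clip.
Context (R : realType) (d : nat).

Definition clip (B : R) (v : 'rV[R]_d) : 'rV[R]_d :=
  \row_i Num.max (- B) (Num.min B (v 0 i)).

Lemma clip_norm B v : 0 <= B -> `|clip B v| <= B.
Proof.
move=> B0; apply: norm_le_coord => // i; rewrite mxE ler_norml.
rewrite le_max lexx /= ge_max ge_min lexx /= andbT; lra.
Qed.

Lemma clip_id B (v : 'rV[R]_d) : (forall i, `|v 0 i| <= B) -> clip B v = v.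
Proof.
move=> vB; apply/rowP => i; rewrite mxE.
by have := vB i; rewrite ler_norml => /andP[v1 v2]; rewrite min_r // max_r.
Qed.

Lemma clip_continuous B : continuous (clip B).
Proof.
move=> v; apply: (@cvg_rV _ _ _ (nbhs v) (nbhs_filter v) _ _
    (fun i u => Num.max (- B) (Num.min B (u 0 i)))
    (fun i => Num.max (- B) (Num.min B (v 0 i)))) => [i u|i|i]; rewrite ?mxE //.
suff : {for v 0 i, continuous
    ((fun=> - B : R^o) \max ((fun=> B : R^o) \min id))}.
  move=> H; exact: (cvg_comp _ _ (@coord_continuous R 1 d 0 i v) H).
apply: continuous_max; first exact: cvg_cst.
by apply: continuous_min; [exact: cvg_cst|exact: cvg_id].
Qed.

End clip.

Section trajectories.
Context (R : realType) (r : {posnum R}) (d : nat).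
Context (dT : measure_display) (T : measurableType dT) (P : probability T R).
Context (F : R -> set (set T)).
Context (M b : R -> 'rV[R]_d -> T -> 'rV[R]_d).
Context (Psi : R -> R -> 'rV[R]_d -> T -> 'rV[R]_d) (w : T).
Hypothesis flow : generated_flow P F M b Psi.
Context (H : R -> history r d -> T -> 'rV[R]_d).
Hypothesis H_cts : jointly_continuous (fun t eta => H t eta w).
Variable tmax : R.
Hypothesis tmax0 : 0 < tmax.
Implicit Types (eta : history r d) (z : R -> 'rV[R]_d) (p : 'rV[R]_d).

Local Notation fmap_w := (flow_map Psi w tmax).
Local Notation frate := (flow_rate Psi w tmax).

(** The path that follows [eta] up to time 0 and the image of [z] under the flow
    afterwards, written as a sum.  When [z] starts at [eta 0], on either side of
    time 0 one of the first two terms equals [eta 0] and cancels. *)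
Definition trajectory eta z t : 'rV[R]_d :=
  hist_ext eta t + fmap_w t (z (ramp tmax t)) - eta (now r).

(** The velocity of [z] for the drift [H + eps (p - x)]; at [eps = 0] it is the
    integrand of the pathwise equation. *)
Definition velocity (eps : R) p eta z t : 'rV[R]_d :=
  \row_i ((H (ramp tmax t) (segment r (trajectory eta z) t) w 0 i
           + eps * (p 0 i - trajectory eta z t 0 i)) / frate t (z t) i).

Lemma velocityE eps p eta z t i : velocity eps p eta z t 0 i =
  (H (ramp tmax t) (segment r (trajectory eta z) t) w 0 i
   + eps * (p 0 i - trajectory eta z t 0 i)) / frate t (z t) i.
Proof. by rewrite /velocity; exact: mxE. Qed.

Lemma trajectory_le0 eta z t : z 0 = eta (now r) -> t <= 0 ->
  trajectory eta z t = hist_ext eta t.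
Proof.
move=> z0 t0; rewrite /trajectory (flow_map_le0 w flow tmax0) //.
by rewrite ramp_le0 ?(ltW tmax0) // z0 addrK.
Qed.

Lemma trajectory_delay eta z (u : delay_itv r) : z 0 = eta (now r) ->
  trajectory eta z (\val u) = eta u.
Proof.
move=> z0; rewrite trajectory_le0 ?hist_ext_delay //.
by have /andP[] := delay_itvP u.
Qed.

Lemma trajectory_ge0 eta z t : 0 <= t -> t <= tmax ->
  trajectory eta z t = fmap_w t (z t).
Proof.
move=> t0 tT; rewrite /trajectory hist_ext_ge0 // ramp_id //.
by rewrite addrAC subrr add0r.
Qed.

Section sequences.
Context (I : Type) (U : set_system I) {UF : ProperFilter U}.
Variables (zn : I -> R -> 'rV[R]_d) (z : R -> 'rV[R]_d).
Hypothesis zn_cvg : cts_cvg U zn z.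

Lemma trajectory_cts_cvg eta :
  cts_cvg U (fun n => trajectory eta (zn n)) (trajectory eta z).
Proof.
have cid : cts_cvg U (fun=> id : R -> R) id by apply: cts_cvg_cst => t; exact: cvg_id.
have c1 := cts_cvg_reparam (UF := UF) (@ramp_continuous R tmax) zn_cvg.
have c2 := cts_cvg_comp2 (UF := UF) cid c1 (@flow_map_continuous _ _ _ _ _ _ _ _ _ w flow tmax).
have c3 : cts_cvg U (fun=> hist_ext eta) (hist_ext eta).
  by apply: cts_cvg_cst; exact: hist_ext_continuous.
move=> t; apply: cvgB; last exact: cvg_cst.
by apply: cvgD; [exact: c3|exact: c2].
Qed.

End sequences.

Lemma trajectory_continuous eta z : continuous z -> continuous (trajectory eta z).
Proof.
move=> cz; apply: (@cts_cvg_continuous _ _ \oo _).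
by apply: trajectory_cts_cvg; exact: cts_cvg_cst.
Qed.

(** The strength [en n] of the perturbation may vary as well, which serves both
    the existence proof (constant strength) and the limit of vanishing
    strength. *)
Lemma velocity_cts_cvg (I : Type) (U : set_system I) {UF : ProperFilter U}
    (zn : I -> R -> 'rV[R]_d) z (en : I -> R) e p eta :
  (forall n, continuous (zn n)) -> continuous z -> cts_cvg U zn z ->
  en n @[n --> U] --> e ->
  cts_cvg U (fun n => velocity (en n) p eta (zn n)) (velocity e p eta z).
Proof.
move=> czn cz zzn ene.
have cid : cts_cvg U (fun=> id : R -> R) id by apply: cts_cvg_cst => t; exact: cvg_id.
have cX := trajectory_cts_cvg (UF := UF) (eta := eta) zzn.
have cS : cts_cvg U (fun n t => segment r (trajectory eta (zn n)) t)
                    (segment r (trajectory eta z)).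
  apply: segment_cts_cvg cX; last exact: trajectory_continuous cz.
  by move=> n; exact: trajectory_continuous (czn n).
have cH : continuous (fun q : R * history r d => H (ramp tmax q.1) q.2 w).
  have cg : continuous (fun q : R * history r d => (ramp tmax q.1, q.2)).
    apply: continuous_pairing; last by move=> q; exact: cvg_snd.
    move=> q; apply: (@continuous_comp _ _ _ fst (ramp tmax)); first exact: cvg_fst.
    exact: ramp_continuous.
  apply: (within_comp_continuous H_cts _ cg) => q /=.
  by rewrite /ramp le_max lexx.
have cHS := cts_cvg_comp2 (UF := UF) cid cS cH.
move=> t; apply: (@cvg_rV _ _ _ (filter_prod U (nbhs t)) _ _ _
  (fun i q => (H (ramp tmax q.2) (segment r (trajectory eta (zn q.1)) q.2) w 0 i
     + en q.1 * (p 0 i - trajectory eta (zn q.1) q.2 0 i)) / frate q.2 (zn q.1 q.2) i)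
  (fun i => (H (ramp tmax t) (segment r (trajectory eta z) t) w 0 i
     + e * (p 0 i - trajectory eta z t 0 i)) / frate t (z t) i)).
- by move=> i q; exact: velocityE.
- by move=> i; exact: velocityE.
move=> i.
have coord (W : I -> R -> 'rV[R]_d) W0 : cts_cvg U W W0 ->
    W q.1 q.2 0 i @[q --> filter_prod U (nbhs t)] --> W0 t 0 i.
  by move=> WW; exact: (cvg_comp _ _ (WW t) (@coord_continuous R 1 d 0 i _)).
have cR := cts_cvg_comp2 (UF := UF) cid zzn
  (@flow_rate_continuous _ _ _ _ _ _ _ _ _ w flow tmax i).
have l1 := coord _ _ cHS.
have l2 := coord _ _ cX.
have l3 := cvg_comp _ _ (@cvg_fst _ _ U (nbhs t) _) ene.
have l4 : (frate q.2 (zn q.1 q.2) i)^-1 @[q --> filter_prod U (nbhs t)]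
          --> (frate t (z t) i)^-1.
  apply: cvgV; last exact: (cR t).
  by rewrite gt_eqF // (flow_rate_gt0 _ flow).
apply: cvgM; last exact: l4.
apply: cvgD; first exact: l1.
apply: cvgM; first exact: l3.
by apply: cvgB; [exact: cvg_cst|exact: l2].
Qed.

Lemma velocity_continuous e p eta z : continuous z ->
  continuous (velocity e p eta z).
Proof.
move=> cz; apply: (@cts_cvg_continuous _ _ \oo _).
apply: (@velocity_cts_cvg _ _ _ (fun=> z) z (fun=> e)) => //; last exact: cvg_cst.
exact: cts_cvg_cst.
Qed.

Lemma velocity_causal e p eta z z' t : 0 <= t ->
  (forall u, 0 <= u -> u <= t -> z u = z' u) ->
  velocity e p eta z t = velocity e p eta z' t.
Proof.
move=> t0 zz.
have X u : u <= t -> trajectory eta z u = trajectory eta z' u.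
  move=> ut; rewrite /trajectory zz // /ramp; first by rewrite le_max lexx.
  by rewrite ge_max t0 /= ge_min ut.
have XS : segment r (trajectory eta z) t = segment r (trajectory eta z') t.
  by apply: eq_segment => u _; exact: X.
apply/rowP => i.
refine (etrans (velocityE e p eta z t i) (etrans _ (esym (velocityE e p eta z' t i)))).
by rewrite XS (X t (lexx t)) (zz t t0 (lexx t)).
Qed.

(** Clipping provides the bound that makes the Euler polygons uniformly
    Lipschitz. *)
Lemma clipped_solution (B eps : R) p eta : 0 <= B -> exists z : R -> 'rV[R]_d,
  [/\ z 0 = eta (now r), lipschitz_path B z &
      approx_primitive tmax 0 (fun t => clip B (velocity eps p eta z t)) z].
Proof.
move=> B0.
refine (@peano R d (fun t z => clip B (velocity eps p eta z t)) (eta (now r))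
  tmax B tmax0 _ _ _).
- by move=> t z; exact: clip_norm.
- move=> t z z' t0 zz; rewrite (@velocity_causal eps p eta z z' t t0) // => u _.
  exact: zz.
- move=> U z zoo UF cz czoo zz.
  have ce : (fun=> eps) n @[n --> U] --> eps by exact: cvg_cst.
  have := velocity_cts_cvg (UF := UF) (p := p) (eta := eta) cz czoo zz ce.
  by move=> cv; exact: (cts_cvg_comp cv (@clip_continuous R d B)).
Qed.

End trajectories.

(** * Invariance and order for perturbed paths *)

Lemma right_slope_lt (R : realType) (f1 f2 : R -> R) (v1 v2 t T : R) :
  f1 t = f2 t -> v1 < v2 ->
  (forall e, 0 < e -> \forall s \near t, t < s -> s <= T ->
     `|f1 s - f1 t - (s - t) * v1| <= e * (s - t)) ->
  (forall e, 0 < e -> \forall s \near t, t < s -> s <= T ->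
     `|f2 s - f2 t - (s - t) * v2| <= e * (s - t)) ->
  \forall s \near t, t < s -> s <= T -> f1 s <= f2 s.
Proof.
move=> f12 v12 s1 s2.
have g0 : 0 < (v2 - v1) / 2 by rewrite divr_gt0 // subr_gt0.
apply: filterS (filterI (s1 _ g0) (s2 _ g0)) => s [h1 h2] ts sT.
have {h1} := h1 ts sT; have {h2} := h2 ts sT.
rewrite f12 !ler_norml => /andP[k1 _] /andP[_ k2]; nra.
Qed.

Section comparison.
Context (R : realType) (r : {posnum R}) (d : nat) (D : set 'rV[R]_d).
Context (dT : measure_display) (T : measurableType dT) (P : probability T R).
Context (F : R -> set (set T)).
Context (M b : R -> 'rV[R]_d -> T -> 'rV[R]_d).
Context (Psi : R -> R -> 'rV[R]_d -> T -> 'rV[R]_d) (w : T).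
Hypothesis flow : generated_flow P F M b Psi.
Hypothesis flowD : forall s t w, 0 <= s -> s < t ->
  (fun x => Psi s t x w) @` D = D.
Context (H : R -> history r d -> T -> 'rV[R]_d).
Hypothesis H_cts : jointly_continuous (fun t eta => H t eta w).
Hypothesis closedD : closed D.
Hypothesis H_inward : forall t eta p eps, 0 <= t -> hist_in D eta ->
  interior D p -> 0 < eps ->
  exists2 a, 0 < a & forall h u, 0 < h -> h <= a -> `|u| <= a ->
    D (eta (now r) + h *: (H t eta w + eps *: (p - eta (now r))) + h *: u).
Hypothesis H_quasimonotone : forall t, 0 <= t ->
  quasimonotone D (fun eta => H t eta w).
Variable tmax : R.
Hypothesis tmax0 : 0 < tmax.
Implicit Types (eta xi : history r d) (z : R -> 'rV[R]_d) (p : 'rV[R]_d).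

Local Notation flow_w := (flow_map Psi w tmax).
Local Notation path := (trajectory Psi w tmax).
Local Notation vel := (velocity Psi w H tmax).

Lemma trajectory_in eta z t : hist_in D eta -> z 0 = eta (now r) ->
  (forall s, 0 <= s -> s <= t -> D (z s)) -> t <= tmax ->
  forall s, s <= t -> D (path eta z s).
Proof.
move=> Deta z0 Dz tT s st; have [s0|s0] := leP s 0.
  by rewrite (trajectory_le0 w flow tmax0 z0 s0); exact: Deta.
rewrite trajectory_ge0 ?(ltW s0) ?(le_trans st tT) //.
by apply/(flow_map_in w flow flowD); apply: Dz => //; exact: ltW.
Qed.

Lemma trajectory_le eta xi z1 z2 t : hist_le eta xi ->
  z1 0 = eta (now r) -> z2 0 = xi (now r) ->
  (forall s, 0 <= s -> s <= t -> forall i, z1 s 0 i <= z2 s 0 i) -> t <= tmax ->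
  forall s i, s <= t -> path eta z1 s 0 i <= path xi z2 s 0 i.
Proof.
move=> etaxi z10 z20 z12 tT s i st; have [s0|s0] := leP s 0.
  rewrite (trajectory_le0 w flow tmax0 z10 s0) (trajectory_le0 w flow tmax0 z20 s0).
  exact: etaxi.
rewrite !trajectory_ge0 ?(ltW s0) ?(le_trans st tT) //.
by apply: (flow_map_le w flow tmax0); apply: z12 => //; exact: ltW.
Qed.

Section one_path.
Variables (eps : R) (p : 'rV[R]_d) (eta : history r d) (z : R -> 'rV[R]_d).
Hypotheses (eps0 : 0 < eps) (Dp : interior D p) (Deta : hist_in D eta).
Hypotheses (cz : continuous z) (z0 : z 0 = eta (now r)).
Hypothesis zP : approx_primitive tmax 0 (vel eps p eta z) z.

Lemma segment_path t (u : delay_itv r) :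
  segment r (path eta z) t u = path eta z (t + \val u).
Proof. by apply: segmentE; exact: (trajectory_continuous flow). Qed.

Lemma segment_path_now t : segment r (path eta z) t (now r) = path eta z t.
Proof. by rewrite segment_path /= addr0. Qed.

Lemma segment_in t : (forall s, 0 <= s -> s <= t -> D (z s)) -> t <= tmax ->
  hist_in D (segment r (path eta z) t).
Proof.
move=> Dz tT u; rewrite segment_path.
apply: (trajectory_in Deta z0 Dz tT); have /andP[_] := delay_itvP u; lra.
Qed.

(** The perturbed velocity, transported by the Jacobian, is the perturbed drift,
    which points strictly into [D]; the flow maps [D] onto itself, so what holds
    for the image path holds for [z]. *)
Lemma stays_inside t : 0 <= t -> t < tmax ->
  (forall s, 0 <= s -> s <= t -> D (z s)) ->
  exists2 h, 0 < h & forall s, t < s -> s < t + h -> s <= tmax -> D (z s).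
Proof.
move=> t0 tT Dz.
have Dseg := segment_in Dz (ltW tT).
have cfl := flow_map_componentwise w flow tmax t.
have dfl := flow_map_differentiable w flow tmax t (z t).
have cvel := velocity_continuous flow H_cts tmax0 (e := eps) (p := p) (eta := eta) cz.
have [||h h0 hD] := @inward_path R d (flow_w t) D z t tmax (vel eps p eta z t)
    cfl dfl _ _.
- by move=> e e0; exact: approx_primitive_right zP cvel t0 tT e0.
- have [a a0 aD] := H_inward t0 Dseg Dp eps0.
  exists a => // h u h0 ha ua.
  have := aD h u h0 ha ua.
  rewrite segment_path_now trajectory_ge0 // ?(ltW tT) //.
  congr (D (_ + _ *: _ + _)); apply/rowP => i.
  rewrite (componentwise_jacobian _ _ cfl dfl) velocityE ramp_id // ?(ltW tT) //.
  rewrite trajectory_ge0 // ?(ltW tT) // mulfVK; last first.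
    by rewrite gt_eqF // (flow_rate_gt0 w flow tmax0).
  by rewrite 4!mxE.
exists h => // s ts sh sT.
by apply/(flow_map_in w flow flowD tmax t); exact: hD.
Qed.

End one_path.

Lemma approx_primitive_coord (phi z : R -> 'rV[R]_d) t e i :
  approx_primitive tmax 0 phi z -> continuous phi -> 0 <= t -> t < tmax ->
  0 < e -> \forall s \near t, t < s -> s <= tmax ->
    `|z s 0 i - z t 0 i - (s - t) * phi t 0 i| <= e * (s - t).
Proof.
move=> zP cphi t0 tT e0.
have [h h0 hP] := approx_primitive_right zP cphi t0 tT e0.
apply/nbhs_ballP; exists h => //= s; rewrite -ball_normE /= => sh ts sT.
have sth : s < t + h by move: sh; rewrite ltr0_norm; lra.
apply: le_trans (hP s (ltW ts) sth sT).
have := coord_le_norm (z s - z t - (s - t) *: phi t) i.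
by rewrite 5!mxE.
Qed.

Section two_paths.
Variables (eps : R) (p q : 'rV[R]_d) (eta xi : history r d).
Variables (z1 z2 : R -> 'rV[R]_d).
Hypotheses (eps0 : 0 < eps) (Dp : interior D p) (Dq : interior D q).
Hypothesis pq : forall i, p 0 i < q 0 i.
Hypotheses (Deta : hist_in D eta) (Dxi : hist_in D xi).
Hypothesis etaxi : hist_le eta xi.
Hypotheses (cz1 : continuous z1) (cz2 : continuous z2).
Hypotheses (z10 : z1 0 = eta (now r)) (z20 : z2 0 = xi (now r)).
Hypothesis z1P : approx_primitive tmax 0 (vel eps p eta z1) z1.
Hypothesis z2P : approx_primitive tmax 0 (vel eps q xi z2) z2.

Definition ordered_inside t :=
  [/\ D (z1 t), D (z2 t) & forall i, z1 t 0 i <= z2 t 0 i].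

(** Equal coordinates of [z] give equal present values of the trajectories and
    equal rates.  Quasimonotonicity orders the drifts, and the perturbations
    make the inequality strict. *)
Lemma velocity_lt t i : 0 <= t -> t <= tmax ->
  (forall s, 0 <= s -> s <= t -> ordered_inside s) -> z1 t 0 i = z2 t 0 i ->
  vel eps p eta z1 t 0 i < vel eps q xi z2 t 0 i.
Proof.
move=> t0 tT Q zi.
have D1 : hist_in D (segment r (path eta z1) t).
  by apply: segment_in => // s s0 st; have [] := Q s s0 st.
have D2 : hist_in D (segment r (path xi z2) t).
  by apply: segment_in => // s s0 st; have [] := Q s s0 st.
have S12 : hist_le (segment r (path eta z1) t) (segment r (path xi z2) t).
  move=> u j; rewrite !segment_path //; apply: (trajectory_le etaxi z10 z20 _ tT).
    by move=> s s0 st; have [] := Q s s0 st.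
  by have /andP[_] := delay_itvP u; lra.
have Xi : path eta z1 t 0 i = path xi z2 t 0 i.
  rewrite !trajectory_ge0 //; exact: (flow_map_componentwise w flow tmax t zi).
have HH := H_quasimonotone t0 D2 D1 (i := i) S12.
rewrite !segment_path_now // in HH.
have {}HH := HH (esym Xi).
have subst_lt (x y x' y' : R) : x = x' -> y = y' -> x' < y' -> x < y.
  by move=> -> ->.
apply: (subst_lt _ _ _ _ (velocityE Psi w H tmax eps p eta z1 t i)
                         (velocityE Psi w H tmax eps q xi z2 t i)).
rewrite ramp_id // Xi (flow_rate_local w flow tmax t zi).
rewrite ltr_pM2r ?invr_gt0 ?(flow_rate_gt0 w flow tmax0) //.
rewrite ler_ltD // ltr_pM2l // ltrD2r.
exact: pq.
Qed.

(** A strictly ordered coordinate stays so by continuity, a tight one because of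
    the strictly ordered velocities. *)
Lemma stays_ordered t : 0 <= t -> t < tmax ->
  (forall s, 0 <= s -> s <= t -> ordered_inside s) ->
  exists2 h, 0 < h & forall s, t < s -> s < t + h -> s <= tmax ->
    forall i, z1 s 0 i <= z2 s 0 i.
Proof.
move=> t0 tT Q.
have cv1 := velocity_continuous flow H_cts tmax0 (e := eps) (p := p) (eta := eta) cz1.
have cv2 := velocity_continuous flow H_cts tmax0 (e := eps) (p := q) (eta := xi) cz2.
suff : \forall s \near t, forall i, t < s -> s <= tmax -> z1 s 0 i <= z2 s 0 i.
  move=> /nbhs_ballP[h /= h0 hP]; exists h => // s ts sh sT i; apply: hP => //.
  by rewrite -ball_normE /= ltr0_norm; lra.
apply: (@filter_forall _ _ (fun i s => t < s -> s <= tmax -> z1 s 0 i <= z2 s 0 i)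
  (nbhs t)) => i.
have [_ _ /(_ i)] := Q t t0 (lexx t); rewrite le_eqVlt => /predU1P[zi|zi]; last first.
  have cd : (z2 s 0 i - z1 s 0 i) @[s --> t] --> z2 t 0 i - z1 t 0 i.
    apply: cvgB; first exact: (coord_comp_continuous cz2).
    exact: (coord_comp_continuous cz1).
  have g0 : 0 < z2 t 0 i - z1 t 0 i by rewrite subr_gt0.
  have /cvgrPdist_lt/(_ _ g0) := cd.
  apply: filterS => s; rewrite ltr_norml => /andP[_ h] _ _; lra.
have vlt := velocity_lt t0 (ltW tT) Q zi.
apply: (@right_slope_lt R (fun s => z1 s 0 i) (fun s => z2 s 0 i) _ _ t tmax zi vlt).
  by move=> e e0; exact: approx_primitive_coord i z1P cv1 t0 tT e0.
by move=> e e0; exact: approx_primitive_coord i z2P cv2 t0 tT e0.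
Qed.

(** Order and membership in [D] are propagated together: velocities are ordered
    only for ordered pasts in [D], and the drift points inwards only for pasts
    in [D].  Both are closed conditions and persist for a short time. *)
Theorem strict_comparison t : 0 <= t -> t <= tmax -> ordered_inside t.
Proof.
apply: real_induction.
- by split; rewrite ?z10 ?z20 // => i; exact: etaxi.
- move=> s s0 sT Q.
  have near_left : \forall u \near s^'-, ordered_inside u.
    near=> u; apply: Q; last by near: u; exact: nbhs_left_lt.
    by apply: ltW; near: u; exact: nbhs_left_gt.
  have l1 := cvg_at_left_filter (cz1 (x := s)).
  have l2 := cvg_at_left_filter (cz2 (x := s)).
  split.
  + apply: (@closed_cvg _ _ (s^'-) _ z1 D closedD _ _ l1).
    by apply: filterS near_left => u [].
  + apply: (@closed_cvg _ _ (s^'-) _ z2 D closedD _ _ l2).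
    by apply: filterS near_left => u [].
  + move=> i; rewrite -subr_ge0.
    have c1 := cvg_comp _ _ l1 (@coord_continuous R 1 d 0 i (z1 s)).
    have c2 := cvg_comp _ _ l2 (@coord_continuous R 1 d 0 i (z2 s)).
    apply: (@closed_cvg _ _ (s^'-) _ (fun u => z2 u 0 i - z1 u 0 i)
      (fun y => 0 <= y) (@closed_ge R 0)); last exact: cvgB c2 c1.
    by apply: filterS near_left => u [_ _ /(_ i)]; rewrite subr_ge0.
- move=> s s0 sT Q.
  have [|h1 h10 H1] := stays_inside eps0 Dp Deta cz1 z10 z1P s0 sT.
    by move=> u u0 us; have [] := Q u u0 us.
  have [|h2 h20 H2] := stays_inside eps0 Dq Dxi cz2 z20 z2P s0 sT.
    by move=> u u0 us; have [] := Q u u0 us.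
  have [h3 h30 H3] := stays_ordered s0 sT Q.
  exists (Num.min h1 (Num.min h2 h3)); first by rewrite !lt_min h10 h20.
  move=> u su; rewrite -ltrBlDl !lt_min !ltrBlDl => /and3P[uh1 uh2 uh3] uT.
  by split; [exact: H1|exact: H2|move=> i; exact: H3].
Unshelve. all: by end_near. Qed.

End two_paths.

End comparison.

(** * Identification of limits by uniqueness *)

Lemma continuous_bounded (R : realType) (V : normedModType R) (f : R -> V) T :
  0 <= T -> continuous f ->
  exists B, forall t, 0 <= t -> t <= T -> `|f t| <= B.
Proof.
move=> T0 cf.
have cn : {within `[0, T], continuous (fun t => `|f t|)}.
  by apply: continuous_subspaceT => t; apply: cvg_norm; exact: cf.
have [c _ cmax] := EVT_max T0 cn.
by exists `|f c| => t t0 tT; apply: cmax; rewrite in_itv /= t0.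
Qed.

Lemma norm_le_near (R : realType) (V : normedModType R) (v v' : V) B :
  `|v - v'| < B - `|v| -> `|v'| <= B.
Proof. by have := lerB_dist v' v; rewrite distrC; lra. Qed.

Lemma eq_vint (R : realType) d (f g : R -> 'rV[R]_d) s t :
  (forall u, s <= u -> u <= t -> f u = g u) -> vint s t f = vint s t g.
Proof.
move=> fg; apply/rowP => i; rewrite !mxE; apply: eq_Rintegral => u.
by rewrite inE /= in_itv /= => /andP[su ut]; rewrite fg.
Qed.

Section uniqueness.
Context (R : realType) (r : {posnum R}) (d : nat).
Context (dT : measure_display) (T : measurableType dT) (P : probability T R).
Context (F : R -> set (set T)).
Context (M b : R -> 'rV[R]_d -> T -> 'rV[R]_d).
Context (Psi : R -> R -> 'rV[R]_d -> T -> 'rV[R]_d) (w : T).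
Hypothesis flow : generated_flow P F M b Psi.
Context (H : R -> history r d -> T -> 'rV[R]_d).
Hypothesis H_cts : jointly_continuous (fun t eta => H t eta w).
Variable tmax : R.
Hypothesis tmax0 : 0 < tmax.
Variables (eta : history r d) (p : 'rV[R]_d).

Local Notation flow_w := (flow_map Psi w tmax).
Local Notation path := (trajectory Psi w tmax eta).
Local Notation vel := (velocity Psi w H tmax 0 p eta).

(** Multiplying by the inverse of the diagonal Jacobian divides each coordinate
    by its rate. *)
Lemma velocity_pathwise_rhs z u : 0 <= u -> u <= tmax ->
  pathwise_rhs Psi H u (flow_inverse Psi u (path z u) w) (segment r (path z) u) w
  = vel z u.
Proof.
move=> u0 uT; rewrite /pathwise_rhs trajectory_ge0 //.
have E := flow_inverse_map w flow tmax u (z u).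
rewrite {1}ramp_id // in E; rewrite E.
have cf := flow_map_componentwise w flow tmax u.
have df := flow_map_diffeo w flow tmax u.
have := componentwise_invmx (z u) (H u (segment r (path z) u) w) cf df.
rewrite {1}/flow_map ramp_id // => ->.
apply/rowP => i; rewrite mxE.
apply: esym; apply: etrans (velocityE Psi w H tmax 0 p eta z u i) _.
by rewrite mul0r addr0 /flow_rate /flow_map ramp_id.
Qed.

(** Primitives of the unperturbed velocity give local solutions in the sense of
    the pathwise equation, to which its uniqueness property applies. *)
Lemma trajectory_solution z T' : continuous z -> z 0 = eta (now r) -> T' <= tmax ->
  approx_primitive T' 0 (vel z) z ->
  pathwise_solution Psi H 0 eta w T'%:E (path z).
Proof.
move=> cz z0 TT zP.
split.
- by apply: continuous_subspaceT; exact: (trajectory_continuous flow).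
- by move=> u; rewrite add0r (trajectory_delay w flow tmax0).
move=> t t0; rewrite lte_fin => /ltW tT.
have tm : t <= tmax := le_trans tT TT.
rewrite trajectory_ge0 // {1}/flow_map ramp_id //.
have cv := velocity_continuous flow H_cts tmax0 (e := 0) (p := p) (eta := eta) cz.
rewrite (approx_primitive_integral zP cv cz t0 tT) z0.
congr (Psi 0 t (_ + _) w).
  have := flow_inverse_map w flow tmax 0 (eta (now r)).
  by rewrite ramp_le0 ?(ltW tmax0) // (flow_map_le0 w flow tmax0).
apply: eq_vint => u u0 ut.
by rewrite velocity_pathwise_rhs // (le_trans ut).
Qed.

Section global_solution_lifting.
Variable x : R -> 'rV[R]_d.
Hypothesis x_sol : global_solution Psi H 0 eta w x.

Definition lifting (t : R) : 'rV[R]_d := flow_back Psi w tmax t (x (ramp tmax t)).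

Lemma lifting_continuous : continuous lifting.
Proof.
have [[cx _ _] _] := x_sol.
have cxr : continuous (x \o ramp tmax).
  apply: (within_comp_continuous cx _ (@ramp_continuous R tmax)) => t /=.
  split; last exact: ltry.
  by rewrite sub0r /ramp le_max; apply/orP; left; rewrite oppr_le0.
have cp : continuous (fun t => (t, x (ramp tmax t))).
  by apply: continuous_pairing cxr => t; exact: cvg_id.
move=> t; exact: (cvg_comp _ _ (cp t) (flow_back_continuous flow (x := _))).
Qed.

Lemma lifting0 : lifting 0 = eta (now r).
Proof.
have [[_ /(_ (now r)) x0 _] _] := x_sol.
rewrite -x0 /= addr0 /lifting /flow_back ramp_le0 ?(ltW tmax0) //.
by rewrite (flow_id flow).
Qed.

Lemma flow_map_lifting t : 0 <= t -> t <= tmax -> flow_w t (lifting t) = x t.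
Proof. by move=> t0 tT; rewrite /lifting (flow_backK w flow) ramp_id. Qed.

(** While [z] coincides with the lifting, its velocity is below the clipping
    level, hence slightly longer by continuity; on that longer interval [z]
    gives a solution of the original equation and must be the given one. *)
Lemma clipped_solution_unique B z : continuous z -> z 0 = eta (now r) ->
  approx_primitive tmax 0 (fun t => clip B (vel z t)) z ->
  (forall t, 0 <= t -> t <= tmax -> `|vel lifting t| < B) ->
  forall t, 0 <= t -> t <= tmax -> z t = lifting t.
Proof.
move=> cz z0 zP velB.
have cl := lifting_continuous.
have cv := velocity_continuous flow H_cts tmax0 (e := 0) (p := p) (eta := eta) cz.
apply: real_induction; first by rewrite z0 lifting0.
- move=> t t0 tT zl; apply/eqP; rewrite -subr_eq0; apply/eqP.
  have c0 : (z u - lifting u) @[u --> t^'-] --> z t - lifting t.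
    by apply: cvgB; apply: cvg_at_left_filter; [exact: cz|exact: cl].
  have near0 : \forall u \near t^'-, z u - lifting u = 0.
    near=> u.
    have u0 : 0 < u by near: u; exact: nbhs_left_gt.
    have ut : u < t by near: u; exact: nbhs_left_lt.
    by rewrite (zl u (ltW u0) ut) subrr.
  apply: (@closed_cvg _ _ (t^'-) _ (fun u => z u - lifting u) [set 0] _ _ _ c0).
    by apply: accessible_closed_set1; apply: hausdorff_accessible; exact: norm_hausdorff.
  exact: near0.
- move=> t t0 tT zl.
  have velE u : 0 <= u -> u <= t -> vel z u = vel lifting u.
    move=> u0 ut; apply: (velocity_causal Psi w H tmax 0 p eta u0) => s s0 su.
    by apply: zl => //; exact: le_trans ut.
  have vt : `|vel z t| < B by rewrite velE ?velB // ltW.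
  have g0 : 0 < B - `|vel z t| by rewrite subr_gt0.
  have /cvgrPdist_lt/(_ _ g0)/nbhs_ballP[h /= h0 hP] := cv t.
  pose T' := Num.min tmax (t + h / 2).
  have TT : T' <= tmax by rewrite ge_min lexx.
  have Th : T' <= t + h / 2 by rewrite ge_min lexx orbT.
  have tT' : t < T' by rewrite lt_min tT ltrDl divr_gt0.
  have clipE u : 0 <= u -> u <= T' -> clip B (vel z u) = vel z u.
    move=> u0 uT; apply: clip_id => i; apply: (le_trans (coord_le_norm _ _)).
    have [ut|tu] := leP u t.
      apply: ltW; rewrite (velE u u0 ut); apply: (velB u u0).
      exact: le_trans ut (ltW tT).
    apply: norm_le_near; apply: hP; rewrite -ball_normE /=.
    by rewrite ltr0_norm; lra.
  have sol := trajectory_solution cz z0 TT (approx_primitive_eq TT clipE zP).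
  have [_ /(_ T'%:E (path z))] := x_sol.
  rewrite lte_fin => /(_ (le_lt_trans t0 tT') sol) uniq.
  exists (T' - t); first by rewrite subr_gt0.
  move=> s ts sT' sT; have s0 : 0 <= s := le_trans t0 (ltW ts).
  have {}sT' : s < T' by lra.
  apply: (flow_map_inj flow (w := w) (tmax := tmax) (t := s)).
  rewrite flow_map_lifting // -(trajectory_ge0 Psi w eta z s0 sT).
  apply: uniq; last by rewrite lte_fin.
  by rewrite sub0r (le_trans _ s0) // oppr_le0.
Unshelve. all: by end_near. Qed.

End global_solution_lifting.

End uniqueness.

(** * Comparison of solutions *)

Lemma interior_chain (R : realType) (d : nat) (D : set 'rV[R]_d) :
  interior D !=set0 -> exists p q, [/\ interior D p, interior D q &
    forall i, p 0 i < q 0 i].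
Proof.
move=> [p Dp]; have := open_interior D; rewrite openE => /(_ p Dp).
move=> /nbhs_ballP[rho /= rho0 rhoD].
exists p, (p + const_mx (rho / 2)); split => //; last first.
  by move=> i; rewrite !mxE ltrDl divr_gt0.
apply: rhoD; rewrite -ball_normE /= opprD addrA subrr sub0r normrN.
apply: (@le_lt_trans _ _ (rho / 2)); last lra.
apply: norm_le_coord => [|i]; first by rewrite divr_ge0 // ltW.
by rewrite mxE ger0_norm // divr_ge0 // ltW.
Qed.

Section comparison_of_solutions.
Context (R : realType) (r : {posnum R}) (d : nat) (D : set 'rV[R]_d).
Context (dT : measure_display) (T : measurableType dT) (P : probability T R).
Context (F : R -> set (set T)).
Context (M b : R -> 'rV[R]_d -> T -> 'rV[R]_d).
Context (Psi : R -> R -> 'rV[R]_d -> T -> 'rV[R]_d) (w : T).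
Hypothesis flow : generated_flow P F M b Psi.
Hypothesis flowD : forall s t w, 0 <= s -> s < t ->
  (fun x => Psi s t x w) @` D = D.
Context (H : R -> history r d -> T -> 'rV[R]_d).
Hypothesis H_cts : jointly_continuous (fun t eta => H t eta w).
Hypothesis closedD : closed D.
Hypothesis interiorD : interior D !=set0.
Hypothesis H_inward : forall t eta p eps, 0 <= t -> hist_in D eta ->
  interior D p -> 0 < eps ->
  exists2 a, 0 < a & forall h u, 0 < h -> h <= a -> `|u| <= a ->
    D (eta (now r) + h *: (H t eta w + eps *: (p - eta (now r))) + h *: u).
Hypothesis H_quasimonotone : forall t, 0 <= t ->
  quasimonotone D (fun eta => H t eta w).

Section approximation.
Variable tmax : R.
Hypothesis tmax0 : 0 < tmax.
Variables (U : set_system nat) (UU : UltraFilter U) (UN : \oo `<=` U).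
Variables (eta : history r d) (p : 'rV[R]_d) (B : R) (x : R -> 'rV[R]_d).
Hypothesis B0 : 0 <= B.
Hypothesis x_sol : global_solution Psi H 0 eta w x.

Local Notation vel := (velocity Psi w H tmax).
Local Notation lift := (lifting Psi w tmax x).

Hypothesis velB : forall t, 0 <= t -> t <= tmax -> `|vel 0 p eta lift t| < B.

(** The clipped perturbed paths converge to the true solution, along which the
    velocity is below [B]; continuous convergence puts their velocities below
    [B] as well, so eventually they solve the perturbed equation without
    clipping. *)
Lemma perturbed_approximation : exists zn : nat -> R -> 'rV[R]_d,
  [/\ forall n, continuous (zn n) /\ zn n 0 = eta (now r),
      \forall n \near U,
        approx_primitive tmax 0 (vel n.+1%:R^-1 p eta (zn n)) (zn n) &
      forall t, 0 <= t -> t <= tmax -> zn n t @[n --> U] --> lift t].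
Proof.
have UF : ProperFilter U by exact: ultra_proper.
have ex n := clipped_solution flow H_cts tmax0 n.+1%:R^-1 p eta B0.
have [zn znP] := choice ex.
have znB n : lipschitz_path B (zn n) by have [] := znP n.
have zn0 n : zn n 0 = eta (now r) by have [] := znP n.
have [z [znz zB z0]] := lipschitz_ultra_limit znB zn0.
have cz := lipschitz_path_continuous zB.
have czn n := lipschitz_path_continuous (znB n).
have eps0 : n.+1%:R^-1 @[n --> U] --> (0 : R).
  by apply: cvg_trans cvg_harmonic; exact: cvg_app UN.
have cvel := velocity_cts_cvg (UF := UF) flow H_cts tmax0 (p := p) (eta := eta)
  czn cz znz eps0.
have cclip := cts_cvg_comp cvel (@clip_continuous R d B).
have zP : approx_primitive tmax 0 (fun t => clip B (vel 0 p eta z t)) z.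
  apply: (@approx_primitive_limit R _ nat U UF tmax (fun=> 0) _ zn _ z _ _ cclip).
  - by move=> e e0; apply: nearW.
  - by apply: nearW => n; have [] := znP n.
  - by move=> t; exact: (cts_cvg_pointwise znz).
have zE := clipped_solution_unique flow H_cts tmax0 x_sol cz z0 zP velB.
exists zn; split => //; last first.
  by move=> t t0 tT; rewrite -zE //; exact: (cts_cvg_pointwise znz).
have inO t : 0 <= t -> t <= tmax ->
    nbhs (vel 0 p eta z t) [set v : 'rV[R]_d | `|v| <= B].
  move=> t0 tT.
  have vt : `|vel 0 p eta z t| < B.
    rewrite (velocity_causal Psi w H tmax 0 p eta (z' := lift) t0); first exact: velB.
    by move=> u u0 ut; apply: zE => //; exact: le_trans ut tT.
  have g0 : 0 < B - `|vel 0 p eta z t| by rewrite subr_gt0.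
  apply/nbhs_ballP; exists (B - `|vel 0 p eta z t|) => //= v.
  by rewrite -ball_normE /= => vv; exact: norm_le_near vv.
have uniform := cts_cvg_uniform (UF := UF) cvel inO.
apply: filterS uniform => n vn; have [_ _] := znP n.
apply: approx_primitive_eq => // u u0 uT.
apply: clip_id => i; apply: le_trans (coord_le_norm _ _) _; exact: vn.
Qed.

End approximation.

(** Both solutions are approximated along the same ultrafilter, at the same
    clipping level and with perturbations towards [p] and [q], and the order of
    the approximations passes to the limit. *)
Theorem pathwise_comparison eta xi x y : hist_in D eta -> hist_in D xi ->
  hist_le eta xi -> global_solution Psi H 0 eta w x ->
  global_solution Psi H 0 xi w y ->
  forall t, 0 <= t -> forall i, x t 0 i <= y t 0 i.
Proof.
move=> Deta Dxi etaxi xS yS t t0 i.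
pose tmax := t + 1; have tmax0 : 0 < tmax by rewrite /tmax; lra.
have tT : t <= tmax by rewrite /tmax; lra.
have [p [q [Dp Dq pq]]] := interior_chain interiorD.
have [U [UU UN]] := ultraFilterLemma (F := \oo) _.
have UF : ProperFilter U by exact: ultra_proper.
have bound zeta v z : global_solution Psi H 0 zeta w z ->
    exists B, forall s, 0 <= s -> s <= tmax ->
      `|velocity Psi w H tmax 0 v zeta (lifting Psi w tmax z) s| <= B.
  move=> zS; apply: (continuous_bounded (ltW tmax0)).
  apply: (velocity_continuous flow H_cts tmax0).
  exact: (lifting_continuous flow zS).
have [B1 B1P] := bound eta p x xS.
have [B2 B2P] := bound xi q y yS.
have B10 : 0 <= B1 := le_trans (normr_ge0 _) (B1P 0 (lexx 0) (ltW tmax0)).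
have B20 : 0 <= B2 := le_trans (normr_ge0 _) (B2P 0 (lexx 0) (ltW tmax0)).
have B0 : 0 <= B1 + B2 + 1 by lra.
have [|z1 [z1c z1P z1x]] := @perturbed_approximation tmax tmax0 U UU UN eta p _ x B0 xS.
  by move=> s s0 sT; apply: (le_lt_trans (B1P s s0 sT)); lra.
have [|z2 [z2c z2P z2y]] := @perturbed_approximation tmax tmax0 U UU UN xi q _ y B0 yS.
  by move=> s s0 sT; apply: (le_lt_trans (B2P s s0 sT)); lra.
have z12 : \forall n \near U, 0 <= z2 n t 0 i - z1 n t 0 i.
  apply: filterS (filterI z1P z2P) => n [h1 h2].
  have [c1 e1] := z1c n; have [c2 e2] := z2c n.
  have e0 : 0 < n.+1%:R^-1 :> R by [].
  have [_ _ /(_ i)] := strict_comparison flow flowD H_cts closedD H_inward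
    H_quasimonotone tmax0 e0 Dp Dq pq Deta Dxi etaxi c1 c2 e1 e2 h1 h2 t0 tT.
  by rewrite subr_ge0.
have k1 := cvg_comp _ _ (z1x t t0 tT) (@coord_continuous R 1 d 0 i _).
have k2 := cvg_comp _ _ (z2y t t0 tT) (@coord_continuous R 1 d 0 i _).
have lift_le : 0 <= lifting Psi w tmax y t 0 i - lifting Psi w tmax x t 0 i.
  apply: (@closed_cvg _ _ U UF (fun n => z2 n t 0 i - z1 n t 0 i)
    (fun v => 0 <= v) (@closed_ge R 0) z12).
  exact: cvgB k2 k1.
rewrite -(flow_map_lifting w flow x t0 tT) -(flow_map_lifting w flow y t0 tT).
by apply: (flow_map_le w flow tmax0); rewrite -subr_ge0.
Qed.

End comparison_of_solutions.

Theorem theorem5p7 (R : realType) (r : {posnum R}) (d : nat)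
    (D : set 'rV[R]_d)
    (* the original filtered probability space and the data on it *)
    (dT : measure_display) (T : measurableType dT) (P : probability T R)
    (F : R -> set (set T))
    (M : R -> 'rV[R]_d -> T -> 'rV[R]_d)
    (a : 'I_d -> 'I_d -> R -> 'rV[R]_d -> 'rV[R]_d -> T -> R)
    (G H : R -> history r d -> T -> 'rV[R]_d)
    (b : R -> 'rV[R]_d -> T -> 'rV[R]_d)
    (Psi : R -> R -> 'rV[R]_d -> T -> 'rV[R]_d)
    (G0 : history r d -> 'rV[R]_d)
    (a0 : 'I_d -> 'I_d -> 'rV[R]_d -> 'rV[R]_d -> R)
    (* the filtered metric dynamical system and the data on it *)
    (dT' : measure_display) (T' : measurableType dT') (P' : probability T' R)
    (theta : R -> T' -> T') (F' : R -> set (set T'))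
    (M' : R -> 'rV[R]_d -> T' -> 'rV[R]_d)
    (H' : R -> history r d -> T' -> 'rV[R]_d)
    (b' : R -> 'rV[R]_d -> T' -> 'rV[R]_d)
    (Psi' : R -> R -> 'rV[R]_d -> T' -> 'rV[R]_d)
    (phi : R -> T' -> hist_in (r := r) D -> hist_in (r := r) D) :
  (0 < d)%N ->
  convex_set (D : set (convex_lmodType 'rV[R]_d)) ->
  closed D ->
  interior D !=set0 ->
  usual_conditions P F ->
  delay_equation P F Psi D M a G H b ->
  (forall t eta w, 0 <= t -> G t eta w = G0 eta) ->
  (forall i j t x y w, 0 <= t -> a i j t x y w = a0 i j x y) ->
  generated_rds P P' G0 a0 M b theta F' M' H' b' Psi' phi ->
  quasimonotone D G0 ->
  filtered_rds P' theta F' phi /\ order_preserving phi.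
Proof.
move=> _ convexD closedD interiorD _ _ _ _ gen QM.
split; first exact: generated_frds gen.
have eqn := generated_equation gen.
have drift := equation_drift eqn.
move=> eta xi etaxi t w t0 u i.
have [x xS phix] := generated_phi gen w eta.
have [y yS phiy] := generated_phi gen w xi.
rewrite phix // phiy //.
have [s0|s0] := leP 0 (t + \val u).
  apply: (pathwise_comparison (D := D) (equation_flow eqn) _ _ closedD interiorD
    _ _ _ _ etaxi xS yS) => //.
  - exact: equation_invariance eqn.
  - exact (functional_continuous (drift_H drift) (w := w)).
  - move=> s zeta p eps; exact: inward_perturbation convexD (equation_inward eqn).
  (* [H'] is [G0] minus a term in which coordinate [j] only sees the present
     value of coordinate [j], which quasimonotonicity keeps fixed. *)
  - move=> s s0' zeta zeta' Dz Dz' j le_zz now_eq.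
    have Gz := drift_decomposition drift zeta w s0'.
    have Gz' := drift_decomposition drift zeta' w s0'.
    have bE := equation_drift_diag eqn w s0' now_eq.
    have := QM zeta zeta' Dz Dz' j le_zz now_eq.
    by rewrite Gz Gz' !mxE bE lerD2r.
  - exact: set_valP.
  - exact: set_valP.
(* Before time 0 the solutions are still the initial histories. *)
have tu : t + \val u \in delay_itv r.
  rewrite inE /delay_itv /= in_itv /=.
  have /andP[u1 _] := delay_itvP u; apply/andP; split; last exact: ltW.
  by rewrite (le_trans u1) // lerDr.
have [[_ xpast _] _] := xS; have [[_ ypast _] _] := yS.
pose v : delay_itv r := exist _ (t + \val u) tu.
have := xpast v; have := ypast v.
rewrite /= add0r => -> ->; exact: etaxi.
Qed.
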